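(* Assume that there is $N_0>0$ such that $\rho_k$ is nondecreasing in $k>N_0$, and that $\rho_k\to1$ as $k\to\infty$. (1) If $\sum_{n=2}^\infty \frac{1}{D(n)\log n}<\infty$ (with the convention $1/\infty=0$), then for each integer $a\ge1$, each $A\subseteq\{a,a+1,\dots\}$ and each $B\subseteq\{1,2,\dots,a\}$, almost surely $|C(A,a)|<\infty$, $|C(a,B)|<\infty$ and $|C_w|<\infty$. (2) If there exist $n_0>0$ and $\delta>0$ such that $D(n)\le\delta n\log n$ for all $n\ge n_0$, and $\sum_{n=2}^\infty \frac{1}{D(n)\log n}=\infty$, then for each integer $a\ge1$, each nonempty $A\subseteq\{a,a+1,\dots\}$ and each nonempty $B\subseteq\{1,2,\dots,a\}$, almost surely $|C(A,a)|=\infty$, $|C(a,B)|=\infty$ and $|C_w|=\infty$.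
   Context: Let $p_0=1$, $q_0=0$, and for $k\ge1$ let $p_k,q_k>0$ with $p_k+q_k=1$. Let $X=(X_k)_{k\ge0}$ be the Markov chain on $\mathbb Z_+=\{0,1,2,\dots\}$ with $X_0=0$ and transition probabilities $\mathbb P(X_{k+1}=n+1\mid X_k=n)=p_n$, $\mathbb P(X_{k+1}=n-1\mid X_k=n)=q_n$ for $n\ge0$. Let $\rho_k=q_k/p_k$ for $k\ge1$. For integers $n\ge m\ge0$ let $D(m,n)=0$ if $n=m$, $D(m,n)=1$ if $n=m+1$, and $D(m,n)=1+\sum_{j=1}^{n-m-1}\rho_{m+1}\cdots\rho_{m+j}$ if $n\ge m+2$; let $D(m)=\lim_{n\to\infty}D(m,n)\in[1,\infty]$. (It is known that $X$ is transient iff $D(0)<\infty$.) For $x\in\mathbb Z_+$ let $\xi(x)=\sum_{k\ge0}1_{\{X_k=x\}}$ (local time) and $\xi(x,\uparrow)=\sum_{k\ge0}1_{\{X_k=x,X_{k+1}=x+1\}}$ (upcrossing time). For $A,B\subseteq\{1,2,\dots\}$ let $C(A,B)=\{x\in\mathbb Z_+:\xi(x)\in A,\ \xi(x,\uparrow)\in B\}$; write $C(a,B)=C(\{a\},B)$, $C(A,b)=C(A,\{b\})$, $C(a,b)=C(\{a\},\{b\})$. A site $R\in\mathbb Z_+$ is a weak cutpoint if for some $k$ we have $X_k=R$, $X_i\le R$ for $0\le i\le k-1$, and $X_i\ge R$ for all $i\ge k+1$; $C_w$ denotes the set of weak cutpoints. $|C|$ is the cardinality of $C$. *)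

(* Defs.v *)
From HB Require Import structures.
From mathcomp Require Import all_boot all_order all_algebra.
From mathcomp Require Import all_classical all_reals all_analysis.
Set Implicit Arguments. Unset Strict Implicit. Unset Printing Implicit Defensive.
Import Order.TTheory GRing.Theory Num.Theory.
Import numFieldNormedType.Exports.
Local Open Scope classical_set_scope.
Local Open Scope ring_scope.

Section Defs.
Variable R : realType.

Definition rho (p : nat -> R) (k : nat) : R := (1 - p k) / p k.

Definition trans (p : nat -> R) (x y : nat) : R :=
  if y == x.+1 then p x else if y.+1 == x then 1 - p x else 0.

Definition Dmn (p : nat -> R) (m n : nat) : R :=
  if (n <= m)%N then 0
  else 1 + \sum_(1 <= j < n - m) \prod_(m.+1 <= i < (m + j).+1) rho p i.

Definition Dinf (p : nat -> R) (m : nat) : \bar R :=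
  limn (fun n => (Dmn p m n)%:E).

Definition Dterm (p : nat -> R) (n : nat) : \bar R :=
  if Dinf p n == +oo%E then 0%E else ((fine (Dinf p n) * ln n%:R)^-1)%:E.

Definition Dseries (p : nat -> R) : \bar R := (\sum_(2 <= n <oo) Dterm p n)%E.

(* X is (a version of) the Markov chain started at 0 with up-probabilities p:
   each X_k is measurable and the finite-dimensional distributions are those
   of the chain. *)
Definition is_chain d (Omega : measurableType d) (P : probability Omega R)
  (p : nat -> R) (X : Omega -> nat -> nat) : Prop :=
  (forall k x, measurable [set w | X w k = x]) /\
  forall (n : nat) (s : nat -> nat),
    P [set w | forall i, (i <= n)%N -> X w i = s i] =
    (((s 0%N == 0%N)%:R) * \prod_(i < n) trans p (s i) (s i.+1))%:E.
End Defs.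

Definition visits (Y : nat -> nat) (x n : nat) : nat :=
  \sum_(k < n) (Y k == x).
Definition upcross (Y : nat -> nat) (x n : nat) : nat :=
  \sum_(k < n) ((Y k == x) && (Y k.+1 == x.+1)).

Definition local_time_eq (Y : nat -> nat) (x m : nat) : Prop :=
  exists N, forall n, (N <= n)%N -> visits Y x n = m.
Definition upcross_eq (Y : nat -> nat) (x m : nat) : Prop :=
  exists N, forall n, (N <= n)%N -> upcross Y x n = m.

Definition Cset (Y : nat -> nat) (A B : set nat) : set nat :=
  [set x | (exists2 m, A m & local_time_eq Y x m) /\
           (exists2 m, B m & upcross_eq Y x m)].

Definition Cw (Y : nat -> nat) : set nat :=
  [set r | exists k, Y k = r /\ (forall i, (i < k)%N -> (Y i <= r)%N) /\
                     (forall i, (k < i)%N -> (r <= Y i)%N)].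

(* Main.v *)
Require Import Defs.
From HB Require Import structures.
From mathcomp Require Import all_boot all_order all_algebra.
From mathcomp Require Import all_classical all_reals all_analysis.
From mathcomp Require Import ring lra zify.
Set Implicit Arguments. Unset Strict Implicit. Unset Printing Implicit Defensive.
Import Order.TTheory GRing.Theory Num.Theory.
Import numFieldNormedType.Exports.
Local Open Scope classical_set_scope.
Local Open Scope ring_scope.

(** Record, at every site [x], the word of up/down letters with which the walk
leaves [x] before it first hits a level [N]. A path is determined by its words,
so a given family of words has probability at most the product of its letter
probabilities. Read from the top site downwards the words form a Markov chain:
a word with [d] down letters at [x + 1] forces [d + 1] up letters at [x], the
last letter being up. For this chain, given that the edge above [n - 1] is
crossed once, the edge above [k] is crossed once with probability [1 / D(k, n)],
and such edges are renewal points.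

Finiteness: in the dyadic block [2^(j+1), 2^(j+2)) look at the rightmost site of
the required type. With probability bounded below the walk never steps down from
it, and then on average at least [(j + 1) / 2] of the edges above sites in
[2^j, 2^(j+2)) are crossed once, since [D(k, n) <= n - k]. Hence the block
contains such a site with probability [O(j^-1 sum_k 1 / D(k))], and Borel-Cantelli
applies.

Infiniteness: let [E_j] be the event that the words at [j], [j + 1], [j + 2] are
three prescribed ones, between two edges crossed once. The weighted count
[S = sum_j 1_(E_j) / ln j] satisfies [Var S <= C * E S], because the covariances
telescope: [sum_l (D(k, l + 1) - D(k, l)) / D(k, l) <= 2 ln D(k)], which is
[O(ln k)]. Chebyshev's inequality then gives [S = oo] almost surely, without any
zero-one law. *)

(** * Nearest-neighbour paths and their departure words *)

Definition nnpath (Y : nat -> nat) :=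
  Y 0%N = 0%N /\ forall i, Y i.+1 = (Y i).+1 \/ (Y i.+1).+1 = Y i.

Definition first_hit (Y : nat -> nat) (N T : nat) :=
  Y T = N /\ forall i, (i < T)%N -> Y i <> N.

Definition word (Y : nat -> nat) (x T : nat) : seq bool :=
  [seq Y i.+1 == x.+1 | i <- iota 0 T & Y i == x].

(** The top site comes first: in this order the words form a Markov chain. *)
Fixpoint words (Y : nat -> nat) (T n : nat) : seq (seq bool) :=
  if n is m.+1 then word Y m T :: words Y T m else [::].

Notation downs w := (count negb w).
Notation ups w := (count id w).

(** The words that can occur at a site below the target level when the edge above it is crossed
    upwards [u] times. The default [true] of [last] admits the empty word, so that [Wset 0] contains
    just [[::]]. *)
Definition Wset (u : nat) : set (seq bool) :=
  [set w | ups w = u /\ last true w = true].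

Section Paths.
Local Open Scope nat_scope.
Implicit Types Y : nat -> nat.

Lemma wordS Y x T : word Y x T.+1 =
  if Y T == x then rcons (word Y x T) (Y T.+1 == x.+1) else word Y x T.
Proof.
have -> : word Y x T.+1 = [seq Y i.+1 == x.+1 | i <- iota 0 (T + 1) & Y i == x].
  by rewrite addn1.
rewrite iotaD add0n filter_cat map_cat /=.
by case: ifP => _ /=; rewrite ?cats0 // cats1.
Qed.

Lemma size_words Y T n : size (words Y T n) = n.
Proof. by elim: n => //= n ->. Qed.

Lemma size_word Y x T : size (word Y x T) = visits Y x T.
Proof.
elim: T => [|T IH]; first by rewrite /visits big_ord0.
rewrite wordS /visits big_ord_recr /= -/(visits Y x T) -IH.
by case: ifP => _; rewrite ?size_rcons ?addn1 ?addn0.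
Qed.

Lemma ups_word Y x T : ups (word Y x T) = upcross Y x T.
Proof.
elim: T => [|T IH]; first by rewrite /upcross big_ord0.
rewrite wordS /upcross big_ord_recr /= -/(upcross Y x T) -IH.
by case: ifP => _ /=; rewrite -?cats1 ?count_cat /= ?addn0.
Qed.

Lemma word_prefix Y x T T' : T <= T' -> exists s, word Y x T' = word Y x T ++ s.
Proof.
move=> /subnK <-; elim: (T' - T) => [|k [s IH]]; first by exists [::]; rewrite cats0.
rewrite addSn wordS IH; case: ifP => _; last by exists s.
by exists (rcons s (Y (k + T).+1 == x.+1)); rewrite rcons_cat.
Qed.

Lemma nnpath_le Y i : nnpath Y -> Y i <= i.
Proof.
case=> Y0 YS; elim: i => [|i IH]; first by rewrite Y0.
by case: (YS i); lia.
Qed.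

Lemma nnpath_cross Y T N : nnpath Y -> N <= Y T -> exists2 i, i <= T & Y i = N.
Proof.
case=> Y0 YS; elim: T => [|T IH] h; first by exists 0 => //; lia.
have [h'|h'] := leqP N (Y T); first by have [i iT Yi] := IH h'; exists i; lia.
by exists T.+1 => //; case: (YS T); lia.
Qed.

Lemma first_hit_lt Y N T i : nnpath Y -> first_hit Y N T -> i < T -> Y i < N.
Proof.
move=> nY [YT hT] iT; rewrite ltnNge; apply/negP => /(nnpath_cross nY)[j ji Yj].
by apply: (hT j) => //; apply: leq_ltn_trans iT.
Qed.

Lemma first_hit_exists Y N t : Y t = N -> exists T, first_hit Y N T.
Proof.
move=> Yt; have ex : exists t, Y t == N by exists t; apply/eqP.
exists (ex_minn ex); case: ex_minnP => m /eqP Ym minm; split => // i im /eqP Yi.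
by have := minm _ Yi; lia.
Qed.

Lemma first_hit_ge Y N T : nnpath Y -> first_hit Y N T -> N <= T.
Proof. by move=> nY [<- _]; exact: nnpath_le. Qed.

(** Up- and downcrossings of the edge between [x] and [x + 1] alternate and start with an
    upcrossing, so they differ by one exactly while the path is above [x]. *)
Lemma ups_downs Y x t : nnpath Y ->
  ups (word Y x t) = downs (word Y x.+1 t) + (x < Y t).
Proof.
case=> Y0 YS; elim: t => [|t IH]; first by rewrite /= Y0.
rewrite !wordS.
case: (Y t =P x) => h1; case: (Y t =P x.+1) => h2; move: IH (YS t);
  rewrite -?cats1 ?count_cat /=; lia.
Qed.

(** Changing sides requires a visit to [x], so the path is still on the side to which it last left
    [x]. *)
Lemma last_word Y x t b : nnpath Y -> word Y x t != [::] -> Y t <> x ->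
  last b (word Y x t) = (x < Y t).
Proof.
case=> Y0 YS; elim: t => [|t IH] //; rewrite wordS.
case: (Y t =P x) => [Ytx _ YSx|Ytx h YSx].
  by rewrite last_rcons; move: (YS t) Ytx YSx; lia.
by rewrite IH //; move: (YS t); lia.
Qed.

Lemma last_word_true Y x N T : nnpath Y -> first_hit Y N T -> x < N ->
  last true (word Y x T) = true.
Proof.
move=> nY [YT _] xN; have [->//|h] := eqVneq (word Y x T) [::].
by rewrite last_word // YT; [exact: xN|lia].
Qed.

Lemma word_top Y N T : nnpath Y -> first_hit Y N.+1 T -> Wset 1 (word Y N T).
Proof.
move=> nY hT; split; last exact: (last_word_true nY hT).
rewrite ups_downs // (proj1 hT) ltnSn /word.
rewrite (_ : [seq i <- iota 0 T | Y i == N.+1] = [::]) //.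
apply/eqP; rewrite -(negbK (_ == _)) -has_filter; apply/hasPn => i.
rewrite mem_iota add0n => /andP[_ iT]; apply/eqP.
by have := first_hit_lt nY hT iT; lia.
Qed.

Lemma word_next Y N T x : nnpath Y -> first_hit Y N T -> x.+1 < N ->
  Wset (downs (word Y x.+1 T)).+1 (word Y x T).
Proof.
move=> nY hT xN; split; last by apply: (last_word_true nY hT); exact: ltnW.
by rewrite ups_downs // (proj1 hT) (ltnW xN) addn1.
Qed.

(* The next step from x is read off as the letter of the word at x whose
   position is the number of previous visits to x. *)
Lemma words_inj Y Y' N T T' : nnpath Y -> nnpath Y' ->
  first_hit Y N T -> first_hit Y' N T' ->
  (forall x, x < N -> word Y x T = word Y' x T') ->
  forall i, i <= T -> Y i = Y' i.
Proof.
move=> nY nY' hT hT' eqw.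
(* The induction also carries [t <= T']: while the common position is below [N], the path [Y'] has
   not stopped either, so its next letter is recorded too. *)
suff H t : t <= T -> t <= T' /\ forall i, i <= t -> Y i = Y' i.
  by move=> i iT; have [_ h] := H i iT; exact: h.
elim: t => [_|t IH tT].
  by split => // i; rewrite leqn0 => /eqP->; case: nY nY' => -> _ [-> _].
have [tT' agree] := IH (ltnW tT).
have Yt : Y t < N := first_hit_lt nY hT tT.
have tT'' : t < T'.
  rewrite ltn_neqAle tT' andbT; apply/eqP => tE.
  by move: (agree t (leqnn _)) Yt; rewrite tE (proj1 hT') => ->; rewrite ltnn.
split => // i; rewrite leq_eqVlt => /orP[/eqP ->|]; last by rewrite ltnS; exact: agree.
have eqt : word Y (Y t) t = word Y' (Y t) t.
  rewrite /word.
  rewrite (eq_in_filter (a2 := fun i => Y' i == Y t)); last first.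
    by move=> j; rewrite mem_iota add0n => /andP[_ jt]; rewrite agree // ltnW.
  apply/eq_in_map => j; rewrite mem_filter mem_iota add0n => /andP[_ /andP[_ jt]].
  by rewrite agree.
have [s es] := word_prefix Y (Y t) tT.
have [s' es'] := word_prefix Y' (Y t) tT''.
have := eqw _ Yt; rewrite es es' !wordS eqxx -agree // eqxx eqt.
rewrite !cat_rcons => /eqP; rewrite eqseq_cat // eqxx /= => /andP[/eqP eqb _].
by move: (proj2 nY t) (proj2 nY' t) eqb; rewrite -(agree t) //; lia.
Qed.

End Paths.

(** * Letter weights of words and paths *)

Section Weights.
Variables (R : realType) (p : nat -> R).

Definition wt (x : nat) (w : seq bool) : R :=
  \prod_(b <- w) (if b then p x else 1 - p x).

Lemma wt_nil x : wt x [::] = 1. Proof. by rewrite /wt big_nil. Qed.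

Lemma wt_cons x b w : wt x (b :: w) = (if b then p x else 1 - p x) * wt x w.
Proof. by rewrite /wt big_cons. Qed.

Lemma wt_cat x v w : wt x (v ++ w) = wt x v * wt x w.
Proof. by rewrite /wt big_cat. Qed.

Lemma wt_nseq x b n : wt x (nseq n b) = (if b then p x else 1 - p x) ^+ n.
Proof. by elim: n => [|n IH]; rewrite ?wt_nil ?expr0 // /= wt_cons IH exprS. Qed.

(** The steps are grouped by starting site; every step before [T] starts below [N], so no factor is
    lost. *)
Lemma prod_trans_wt (Y : nat -> nat) N T : nnpath Y ->
  (forall i, (i < T)%N -> (Y i < N)%N) ->
  \prod_(i < T) trans p (Y i) (Y i.+1) = \prod_(x < N) wt x (word Y x T).
Proof.
move=> nY; elim: T => [|T IH] hT.
  by rewrite big_ord0 big1 // => x _; rewrite wt_nil.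
rewrite big_ord_recr /= IH; last by move=> i iT; apply: hT; exact: leqW.
have YT : (Y T < N)%N by apply: hT.
rewrite (bigD1 (Ordinal YT)) //= [RHS](bigD1 (Ordinal YT)) //=.
rewrite wordS eqxx -cats1 wt_cat wt_cons wt_nil mulr1 mulrAC; congr (_ * _ * _).
  rewrite /trans; case: eqP => // hne.
  by case: (proj2 nY T) => [/hne//|->]; rewrite eqxx.
apply: eq_bigr => x xYT; rewrite wordS; case: eqP => // e.
by move: xYT; rewrite -val_eqE /= e eqxx.
Qed.

End Weights.

(** * Scaling of extended-real sums *)

Section EsumScale.
Context {R : realType} {T : choiceType}.
Local Open Scope ereal_scope.

Lemma esumZ_le (I : set T) (c : R) (a : T -> \bar R) : (0 <= c)%R ->
  (forall i, 0 <= a i) ->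
  \esum_(i in I) (c%:E * a i) <= c%:E * \esum_(i in I) a i.
Proof.
move=> c0 a0; apply: ge_ereal_sup => _ [X [finX XI]] <-.
rewrite -ge0_mule_fsumr //.
by apply: lee_wpmul2l => //; apply: ereal_sup_ubound; exists X.
Qed.

Lemma esumZ (I : set T) (c : R) (a : T -> \bar R) : (0 <= c)%R ->
  (forall i, 0 <= a i) ->
  \esum_(i in I) (c%:E * a i) = c%:E * \esum_(i in I) a i.
Proof.
move=> c0 a0; apply/eqP; rewrite eq_le esumZ_le //=.
have [->|cn0] := eqVneq c 0%R; first by rewrite mul0e esum_ge0 // => i _; rewrite mul0e.
have cp : (0 < c)%R by rewrite lt_neqAle eq_sym cn0.
(* The reverse inequality is the first one applied with the factor [c^-1]. *)
have -> : \esum_(i in I) a i = \esum_(i in I) (c^-1%:E * (c%:E * a i)).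
  by apply: eq_esum => i _; rewrite muleA -EFinM mulVf // mul1e.
apply: (@le_trans _ _ (c%:E * (c^-1%:E * \esum_(i in I) (c%:E * a i)))).
  apply: lee_wpmul2l; first by rewrite lee_fin.
  by apply: esumZ_le => [|i]; rewrite ?invr_ge0 // mule_ge0.
by rewrite muleA -EFinM mulfV // mul1e.
Qed.

End EsumScale.

(** * The law of a word with a given number of up letters *)

Section Kernel.
Variables (R : realType) (p : nat -> R).
Hypothesis p_gt0 : forall x, 0 < p x.
Hypothesis p_le1 : forall x, p x <= 1.
Local Open Scope ereal_scope.

Let q_ge0 x : (0 <= 1 - p x)%R.
Proof. by rewrite subr_ge0. Qed.

Lemma wt_ge0 x w : (0 <= wt p x w)%R.
Proof. by apply: prodr_ge0 => b _; case: b => //; rewrite ltW. Qed.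

(** Integration against the law of independent letters at [x] read until the [u]-th [true]; that the
    total mass is one is shown in [K1]. *)
Definition K (x u : nat) (F : seq bool -> \bar R) : \bar R :=
  \esum_(w in Wset u) ((wt p x w)%:E * F w).

Lemma le_K x u F G : (forall w, Wset u w -> F w <= G w) -> K x u F <= K x u G.
Proof.
by move=> h; apply: le_esum => w /h; apply: lee_wpmul2l; rewrite lee_fin wt_ge0.
Qed.

Lemma eq_K x u F G : (forall w, Wset u w -> F w = G w) -> K x u F = K x u G.
Proof. by move=> h; apply: eq_esum => w /h ->. Qed.
Arguments eq_K {x u F} G _.

Lemma K_ge0 x u F : (forall w, 0 <= F w) -> 0 <= K x u F.
Proof. by move=> h; apply: esum_ge0 => w _; rewrite mule_ge0 // lee_fin wt_ge0. Qed.

Lemma KD x u F G : (forall w, 0 <= F w) -> (forall w, 0 <= G w) ->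
  K x u (fun w => F w + G w) = K x u F + K x u G.
Proof.
move=> F0 G0; rewrite /K -esumD.
- by apply: eq_esum => w _; rewrite ge0_muleDr.
- by move=> w _; rewrite mule_ge0 // lee_fin wt_ge0.
- by move=> w _; rewrite mule_ge0 // lee_fin wt_ge0.
Qed.

Lemma KZ x u c F : (0 <= c)%R -> (forall w, 0 <= F w) ->
  K x u (fun w => c%:E * F w) = c%:E * K x u F.
Proof.
move=> c0 F0; rewrite /K -esumZ //.
  by apply: eq_esum => w _; rewrite muleCA.
by move=> w; rewrite mule_ge0 // lee_fin wt_ge0.
Qed.

Lemma Wset0 : Wset 0 = [set [::]].
Proof.
apply/seteqP; split => [w [h1 h2]|w ->] //=.
case/lastP: w h1 h2 => [//|w b]; rewrite last_rcons => + bt.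
by rewrite bt -cats1 count_cat /= !addn1.
Qed.

Lemma K0 x F : 0 <= F [::] -> K x 0 F = F [::].
Proof. by move=> F0; rewrite /K Wset0 esum_set1 wt_nil mul1e. Qed.

(** Condition on the first letter: after [true] there remain [u] up letters to read, after [false]
    still [u + 1]. *)
Lemma KS x u F : (forall w, 0 <= F w) ->
  K x u.+1 F = (p x)%:E * K x u (fun w => F (true :: w)) +
               (1 - p x)%:E * K x u.+1 (fun w => F (false :: w)).
Proof.
move=> F0; rewrite {1}/K (esumID [set w | head false w]); last first.
  by move=> w _; rewrite mule_ge0 // lee_fin wt_ge0.
have -> : Wset u.+1 `&` [set w | head false w] = cons true @` Wset u.
  apply/seteqP; split => [w [[h1 h2] hb]|_ [w [h1 h2] <-]].
    by case: w h1 h2 hb => [//|[] w] //= -[h1] h2 _; exists w.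
  by split=> //; split=> //=; rewrite h1.
have -> : Wset u.+1 `&` ~` [set w | head false w] = cons false @` Wset u.+1.
  apply/seteqP; split => [w [[h1 h2] hb]|_ [w [h1 h2] <-]].
    case: w h1 h2 hb => [//|[] w] //= h1 h2 hb.
    by exists w => //; split => //; move: h1 h2; case: w.
  by split=> //; split => //=; move: h1 h2; case: w.
rewrite !esum_image; try by move=> ? ? _ _ [].
rewrite -!esumZ // ?ltW //; try by move=> w; rewrite mule_ge0 // lee_fin wt_ge0.
by congr (_ + _); apply: eq_esum => w _; rewrite wt_cons EFinM muleA.
Qed.

(** The recursion [KS] does not by itself rule out infinite mass. Truncating at word length [m]
    allows an induction on [m], with a bound uniform in [m]. *)
Lemma K_size_le x m u : K x u (fun w => (size w <= m)%:R%:E) <= 1.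
Proof.
have i0 k (w : seq bool) : 0 <= (size w <= k)%:R%:E :> \bar R by rewrite lee_fin ler0n.
elim: m u => [|m IH] [|u]; rewrite ?K0 ?lee_fin ?ler0n //.
  rewrite KS //=.
  have E (v : nat) : K x v (fun w => false%:R%:E) = 0.
    by apply: esum1 => w _; rewrite mule0.
  by rewrite !E !mule0 adde0.
rewrite KS // (eq_K ((fun w => (size w <= m)%:R%:E))) //.
rewrite [X in _ + _ * X](eq_K ((fun w => (size w <= m)%:R%:E))) //.
have -> : 1 = (p x)%:E * 1 + (1 - p x)%:E * 1 :> \bar R.
  by rewrite !mule1 -EFinD addrC subrK.
by apply: leeD; apply: lee_wpmul2l; rewrite ?lee_fin // ltW.
Qed.

Lemma K1_le x u : K x u (fun=> 1) <= 1.
Proof.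
apply: ge_ereal_sup => _ [X [finX XW]] <-.
have [m hm] : exists m, forall w, X w -> (size w <= m)%N.
  have /finite_seqP[s ->] := finX.
  exists (\max_(w <- s) size w)%N => w /= ws.
  by rewrite (big_rem w) //= leq_maxl.
apply: le_trans (K_size_le x m u).
apply: esum_ge; exists X => //.
apply: lee_fsum => // w Xw; rewrite hm //.
Qed.

(** The generating function at [s] of the number of down letters before the first up letter. *)
Definition geo (x : nat) (s : R) : R := (p x / (1 - (1 - p x) * s))%R.

Lemma geo_den x s : (0 <= s <= 1)%R -> (0 < 1 - (1 - p x) * s)%R.
Proof. by move=> /andP[s0 s1]; have := p_gt0 x; have := q_ge0 x; nra. Qed.

Lemma K_pow x u s : (0 <= s <= 1)%R ->
  K x u (fun w => (s ^+ downs w)%:E) = (geo x s ^+ u)%:E.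
Proof.
move=> /[dup] s01 /andP[s0 s1].
have g0 w : 0 <= (s ^+ downs w)%:E by rewrite lee_fin exprn_ge0.
elim: u => [|u IH]; first by rewrite K0 // expr0.
set k := K x u.+1 _.
(* First-letter conditioning gives a linear equation for [k]; it can be solved because [k] is at
   most one, hence finite. *)
have kE : k = (p x * geo x s ^+ u)%:E + ((1 - p x) * s)%:E * k.
  rewrite {1}/k KS // IH EFinM; congr (_ + _).
  rewrite EFinM -muleA; congr (_ * _); rewrite /k -KZ //; apply: eq_K => w _ /=.
  by rewrite exprS EFinM.
have k0 : 0 <= k by apply: K_ge0.
have k1 : k <= 1.
  apply: le_trans (K1_le x u.+1); apply: le_K => w _.
  by rewrite lee_fin exprn_ile1.
have kf : k \is a fin_num.
  by rewrite fin_numE; apply/andP; split; apply/eqP => e; move: k0 k1; rewrite e.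
move: kE; rewrite -(fineK kf) -EFinM -EFinD => -[kE].
congr EFin; rewrite exprS.
have d0 := lt0r_neq0 (geo_den x s01).
apply: (mulfI d0); rewrite mulrBl mul1r {1}kE.
by rewrite /geo; field.
Qed.

Lemma geo1 x : geo x 1 = 1%R.
Proof. by rewrite /geo mulr1 opprB addrC subrK divff // lt0r_neq0. Qed.

Lemma K1 x u : K x u (fun=> 1) = 1.
Proof.
rewrite (eq_K (fun w => (1 ^+ downs w)%:E)); last by move=> w _; rewrite expr1n.
by rewrite K_pow ?ler01 ?lexx // geo1 expr1n.
Qed.

Lemma K_pin x u v F : Wset u v -> 0 <= F v ->
  K x u (fun w => (w == v)%:R%:E * F w) = (wt p x v)%:E * F v.
Proof.
move=> Wv Fv; rewrite /K.
rewrite (eq_esum (b := fun w => if w \in [set v] then (wt p x w)%:E * F w else 0)).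
  rewrite -esum_mkcondr (_ : Wset u `&` [set v] = [set v]).
    by rewrite esum_set1 // mule_ge0 // lee_fin wt_ge0.
  by apply/seteqP; split => [w []|w ->].
move=> w _; rewrite in_set1; case: eqP => _ /=; first by rewrite mul1e.
by rewrite mul0e mule0.
Qed.

Lemma K_ge_pin x u v F : (forall w, 0 <= F w) -> Wset u v ->
  (wt p x v)%:E * F v <= K x u F.
Proof.
move=> F0 Wv; rewrite -(K_pin x Wv) //; apply: le_K => w _.
case: eqP => _; first by rewrite mul1e.
by rewrite mul0e.
Qed.

Lemma Wset_nseq u : Wset u (nseq u true).
Proof. by split; [rewrite count_nseq mul1n|case: u => //= u; elim: u]. Qed.

(** The shape that a weak cutpoint forces on its word: down letters first, then up letters only. *)
Fixpoint down_up (w : seq bool) : bool :=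
  if w is b :: w' then if b then all id w' else down_up w' else true.

Lemma down_up_nseq u : down_up (nseq u true).
Proof. by case: u => //= u; elim: u. Qed.

Lemma K_all_true x u : K x u (fun w => (all id w)%:R%:E) = (p x ^+ u)%:E.
Proof.
rewrite (eq_K (fun w => (w == nseq u true)%:R%:E * 1)).
  by rewrite K_pin //; [rewrite wt_nseq mule1|exact: Wset_nseq].
move=> w [<- _]; rewrite mule1; congr (_%:R%:E); congr nat_of_bool.
by elim: w => //= -[] w IH; rewrite ?eqseq_cons /= ?IH //; case: (ups w).
Qed.

(** The number of leading down letters is free and sums to the geometric series [1 / p x]. So among
    the down-then-up words with [u + 1] up letters, the word without down letters has the share
    [p x] of the weight. *)
Lemma K_down_up x u :
  (p x)%:E * K x u.+1 (fun w => (down_up w)%:R%:E) = (wt p x (nseq u.+1 true))%:E.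
Proof.
have i0 (w : seq bool) : 0 <= (down_up w)%:R%:E :> \bar R by rewrite lee_fin ler0n.
set k := K _ _ _.
have kE : k = (p x * p x ^+ u)%:E + (1 - p x)%:E * k.
  by rewrite {1}/k KS //= K_all_true EFinM.
have k0 : 0 <= k by apply: K_ge0.
have k1 : k <= 1.
  apply: le_trans (K1_le x u.+1); apply: le_K => w _.
  by rewrite lee_fin lern1 leq_b1.
have kf : k \is a fin_num.
  by rewrite fin_numE; apply/andP; split; apply/eqP => e; move: k0 k1; rewrite e.
move: kE; rewrite -(fineK kf) -!EFinM -EFinD => -[kE].
congr EFin; rewrite wt_nseq exprS; move: kE; lra.
Qed.

(* Expectation of [F] at the words of the sites [n - 1], ..., [0], given that the
   word at [n] has [z] down letters. *)
Fixpoint Eb (n z : nat) (F : seq (seq bool) -> \bar R) : \bar R :=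
  if n is m.+1 then K m z.+1 (fun w => Eb m (downs w) (fun t => F (w :: t)))
  else F [::].

Lemma EbS n z F :
  Eb n.+1 z F = K n z.+1 (fun w => Eb n (downs w) (fun t => F (w :: t))).
Proof. by []. Qed.

Lemma Eb_ge0 n z F : (forall t, 0 <= F t) -> 0 <= Eb n z F.
Proof. by elim: n z F => [|n IH] z F F0 //=; apply: K_ge0 => w; exact: IH. Qed.

Lemma le_Eb n z F G : (forall t, size t = n -> F t <= G t) -> Eb n z F <= Eb n z G.
Proof.
elim: n z F G => [|n IH] z F G h /=; first exact: h.
by apply: le_K => w _; apply: IH => t st; apply: h; rewrite /= st.
Qed.

Lemma eq_Eb n z F G : (forall t, size t = n -> F t = G t) -> Eb n z F = Eb n z G.
Proof.
elim: n z F G => [|n IH] z F G h /=; first exact: h.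
by apply: eq_K => w _; apply: IH => t st; apply: h; rewrite /= st.
Qed.
Arguments eq_Eb {n z F} G _.

Lemma EbD n z F G : (forall t, 0 <= F t) -> (forall t, 0 <= G t) ->
  Eb n z (fun t => F t + G t) = Eb n z F + Eb n z G.
Proof.
elim: n z F G => [|n IH] z F G F0 G0 //=.
by rewrite -KD => [|w|w]; try exact: Eb_ge0; apply: eq_K => w _; exact: IH.
Qed.

Lemma EbZ n z c F : (0 <= c)%R -> (forall t, 0 <= F t) ->
  Eb n z (fun t => c%:E * F t) = c%:E * Eb n z F.
Proof.
elim: n z F => [|n IH] z F c0 F0 //=.
by rewrite -KZ // => [|w]; [apply: eq_K => w _; exact: IH|exact: Eb_ge0].
Qed.

Lemma Eb_sum (I : Type) (r : seq I) (P : pred I) n z (F : I -> seq (seq bool) -> \bar R) :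
  (forall i t, 0 <= F i t) ->
  Eb n z (fun t => \sum_(i <- r | P i) F i t) = \sum_(i <- r | P i) Eb n z (F i).
Proof.
move=> F0; elim: r => [|i r IH].
  rewrite big_nil (eq_Eb (fun t => 0%:E * 0)); last by move=> t _; rewrite big_nil mul0e.
  by rewrite EbZ // mul0e.
rewrite big_cons -IH; case: (boolP (P i)) => Pi.
  rewrite -EbD //; last by move=> t; apply: sume_ge0 => j _; exact: F0.
  by apply: eq_Eb => t _; rewrite big_cons Pi.
by apply: eq_Eb => t _; rewrite big_cons (negbTE Pi).
Qed.

Lemma Eb1 n z : Eb n z (fun=> 1) = 1.
Proof. by elim: n z => //= n IH z; rewrite (eq_K (fun=> 1)) ?K1. Qed.

End Kernel.
Arguments eq_K {R p x u F} G _.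
Arguments eq_Eb {R p n z F} G _.

(** * The sums D(m, n) and gambler's ruin *)

Section Dmn_theory.
Variables (R : realType) (p : nat -> R).
Hypothesis p_gt0 : forall x, 0 < p x.
Hypothesis p_le1 : forall x, p x <= 1.

(** Indexed by its last factor, so that D(m, n) becomes the sum over [m <= j < n]; for [j = m] the
    product is empty. *)
Definition rho_prod (m j : nat) : R := \prod_(m.+1 <= i < j.+1) rho p i.

Lemma rho_ge0 x : 0 <= rho p x.
Proof. by rewrite /rho divr_ge0 ?subr_ge0 // ltW. Qed.

Lemma rho_prod_ge0 m j : 0 <= rho_prod m j.
Proof. by apply: prodr_ge0 => i _; exact: rho_ge0. Qed.

Lemma rho_prod_diag m : rho_prod m m = 1.
Proof. by rewrite /rho_prod big_geq. Qed.

Lemma rho_prodS m j : (m <= j)%N -> rho_prod m j.+1 = rho_prod m j * rho p j.+1.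
Proof. by move=> mj; rewrite /rho_prod big_nat_recr. Qed.

Lemma DmnE m n : Dmn p m n = \sum_(m <= j < n) rho_prod m j.
Proof.
rewrite /Dmn; case: leqP => mn; first by rewrite big_geq.
rewrite (big_ltn mn) rho_prod_diag; congr (_ + _).
rewrite -{2}(add1n m) big_addn; apply: eq_big_nat => j _.
by rewrite /rho_prod addnC.
Qed.

Lemma DmnS m n : (m <= n)%N -> Dmn p m n.+1 = Dmn p m n + rho_prod m n.
Proof. by move=> mn; rewrite !DmnE big_nat_recr. Qed.

Lemma Dmn_diag m : Dmn p m m = 0.
Proof. by rewrite DmnE big_geq. Qed.

Lemma Dmn_diagS m : Dmn p m m.+1 = 1.
Proof. by rewrite DmnS // Dmn_diag rho_prod_diag add0r. Qed.

Lemma Dmn_le m n n' : (n <= n')%N -> Dmn p m n <= Dmn p m n'.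
Proof.
move=> nn'; have [mn|mn] := leqP m n; last first.
  rewrite DmnE big_geq ?(ltnW mn) // DmnE sumr_ge0 // => j _; exact: rho_prod_ge0.
rewrite !DmnE (big_cat_nat mn nn') lerDl sumr_ge0 // => j _; exact: rho_prod_ge0.
Qed.

Lemma Dmn_ge1 m n : (m < n)%N -> 1 <= Dmn p m n.
Proof. by move=> mn; rewrite -(Dmn_diagS m); exact: Dmn_le. Qed.

Lemma Dmn_gt0 m n : (m < n)%N -> 0 < Dmn p m n.
Proof. by move=> /Dmn_ge1; exact: lt_le_trans. Qed.

Lemma Dmn_ge0 m n : 0 <= Dmn p m n.
Proof.
have [nm|mn] := leqP n m; last exact: ltW (Dmn_gt0 mn).
by rewrite DmnE big_geq.
Qed.

Lemma Dmn_split m l n : (m <= l)%N -> (l <= n)%N ->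
  Dmn p m n = Dmn p m l + rho_prod m l * Dmn p l n.
Proof.
move=> ml ln; rewrite !DmnE (big_cat_nat ml ln) /=; congr (_ + _).
rewrite mulr_sumr; apply: eq_big_nat => j /andP[lj jn].
by rewrite /rho_prod (@big_cat_nat _ _ _ l.+1).
Qed.

(** [Dmn p k n / Dmn p k n.+1] is the probability of reaching [n + 1] from [n] before [k]: each down
    letter at [n] has to be followed by a return to [n] before [k]. This identity propagates the
    renewal formula from one site to the next. *)
Lemma geo_Dmn k n : (k < n)%N ->
  geo p n (Dmn p k n.-1 / Dmn p k n) = Dmn p k n / Dmn p k n.+1.
Proof.
case: n => // n; rewrite ltnS => kn /=.
have a0 := Dmn_gt0 (leqW kn : (k < n.+2)%N).
have b0 : 0 < Dmn p k n.+1 by apply: Dmn_gt0.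
have r0 := rho_prod_ge0 k n.
have c0 := Dmn_ge0 k n.
have h1 := DmnS kn.
have h2 : p n.+1 * Dmn p k n.+2 = p n.+1 * Dmn p k n.+1 + (1 - p n.+1) * rho_prod k n.
  rewrite [X in _ * X = _]DmnS ?leqW // rho_prodS // /rho; field.
  by rewrite lt0r_neq0.
have pn := p_gt0 n.+1.
have q0 : 0 <= 1 - p n.+1 by rewrite subr_ge0.
rewrite /geo.
have d0 : 0 < 1 - (1 - p n.+1) * (Dmn p k n / Dmn p k n.+1).
  apply: geo_den => //; apply/andP; split; first by rewrite divr_ge0 // ltW.
  by rewrite ler_pdivrMr // mul1r; exact: Dmn_le.
apply/eqP; rewrite eqr_div ?lt0r_neq0 //; apply/eqP.
rewrite h2 mulrBr mulr1 mulrCA [X in _ - _ * X]mulrC divfK ?lt0r_neq0 //.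
by rewrite h1; ring.
Qed.

End Dmn_theory.

(** * Words of the lowest sites, and three-site patterns *)

Definition low (k : nat) (t : seq (seq bool)) := drop (size t - k) t.

Lemma low_id t : low (size t) t = t.
Proof. by rewrite /low subnn drop0. Qed.

Lemma low_cons k w t : (k <= size t)%N -> low k (w :: t) = low k t.
Proof. by move=> kt; rewrite /low /= subSn. Qed.

Lemma size_low k t : (k <= size t)%N -> size (low k t) = k.
Proof. by move=> kt; rewrite /low size_drop subKn. Qed.

Lemma low_low k l t : (k <= l)%N -> (l <= size t)%N -> low k (low l t) = low k t.
Proof.
move=> kl lt_; rewrite {1}/low size_low // /low drop_drop; congr drop; lia.
Qed.

(** Down letters at a site force as many up letters, plus one, at the site below: [n] downs in
    [pat2] match the [n + 1] ups of [pat1], and [m] downs there match the [m + 1] ups of [pat0]. *)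
Definition pat2 (n : nat) := rcons (nseq n false) true.
Definition pat1 (m n : nat) := nseq m false ++ nseq n.+1 true.
Definition pat0 (m : nat) := nseq m.+1 true.

(* On words, this pattern says that the edges below [j] and above [j + 2] are
   crossed once and that the walk departs [m + n + 1] times from [j + 1],
   [n + 1] times upwards. *)
Definition pattern (m n j : nat) (t : seq (seq bool)) : bool :=
  take 3 (low j.+3 t) == [:: pat2 n; pat1 m n; pat0 m].

Lemma Wset_pat2 n : Wset 1 (pat2 n).
Proof. by split; rewrite /pat2 ?last_rcons // -cats1 count_cat count_nseq. Qed.

Lemma downs_pat2 n : downs (pat2 n) = n.
Proof. by rewrite /pat2 -cats1 count_cat count_nseq /= mul1n !addn0. Qed.

Lemma Wset_pat1 m n : Wset n.+1 (pat1 m n).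
Proof.
split; first by rewrite /pat1 count_cat !count_nseq mul0n mul1n.
by rewrite /pat1 last_cat /=; elim: n.
Qed.

Lemma downs_pat1 m n : downs (pat1 m n) = m.
Proof. by rewrite /pat1 count_cat !count_nseq mul0n mul1n addn0. Qed.

Lemma downs_pat0 m : downs (pat0 m) = 0%N.
Proof. by rewrite count_nseq. Qed.

(** * Renewal at edges crossed once *)

Section Renewal.
Variables (R : realType) (p : nat -> R).
Hypothesis p_gt0 : forall x, 0 < p x.
Hypothesis p_le1 : forall x, p x <= 1.
Local Open Scope ereal_scope.

(* Conditionally on the words at the sites [>= n] with [z] down letters at [n],
   the edge above [k] is crossed once with probability
   [D(k,n)^-1 (D(k,n-1)/D(k,n))^z], and then the words below start afresh. *)
Lemma Eb_zero k n z H c : (k < n)%N -> (forall t, 0 <= H t) -> (0 <= c)%R ->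
  Eb p k.+1 0 H = c%:E ->
  Eb p n z (fun t => (ups (head [::] (low k.+1 t)) == 1%N)%:R%:E * H (low k.+1 t))
  = ((Dmn p k n)^-1 * (Dmn p k n.-1 / Dmn p k n) ^+ z * c)%:E.
Proof.
case: n => // n; rewrite ltnS => kn H0 c0 EH.
have F0 t : 0 <= (ups (head [::] (low k.+1 t)) == 1%N)%:R%:E * H (low k.+1 t).
  by rewrite mule_ge0 // lee_fin ler0n.
move: kn => /subnK <-; elim: (n - k)%N z => [|m IH] z.
  (* At the lowest level the word at [k] has [z + 1] up letters, so the edge is crossed once only if
     [z = 0]; the ratio is D(k, k) / D(k, k + 1) = 0, and [0 ^+ z] says the same. *)
  rewrite add0n Dmn_diagS Dmn_diag /= invr1 mul0r mul1r.
  case: z => [|z].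
    rewrite expr0 mul1r -EH /=; apply: eq_K => w [uw _].
    apply: eq_Eb => t st; rewrite (_ : low k.+1 (w :: t) = w :: t) /= ?uw ?mul1e //.
    by rewrite -{1}st -[(size t).+1]/(size (w :: t)) low_id.
  rewrite expr0n /= mul0r; apply: esum1 => w [uw _].
  rewrite (eq_Eb (fun t => 0%:E * 0)) ?EbZ ?mul0e ?mule0 // => t st.
  rewrite (_ : low k.+1 (w :: t) = w :: t) /= ?uw //; first by rewrite !mul0e.
  by rewrite -{1}st -[(size t).+1]/(size (w :: t)) low_id.
rewrite addSn EbS.
rewrite (eq_K (fun w => ((Dmn p k (m + k).+1)^-1 * c)%:E *
   ((Dmn p k (m + k) / Dmn p k (m + k).+1) ^+ downs w)%:E)); last first.
  move=> w _; rewrite -EFinM mulrAC -[RHS](IH (downs w)).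
  apply: eq_Eb => t st; rewrite low_cons // st; lia.
have D0 : (0 < Dmn p k (m + k).+1)%R by apply: Dmn_gt0 => //; lia.
have D0' : (0 < Dmn p k (m + k).+2)%R by apply: Dmn_gt0 => //; lia.
have Dr : (0 <= Dmn p k (m + k) / Dmn p k (m + k).+1 <= 1)%R.
  rewrite divr_ge0 ?Dmn_ge0 //= ler_pdivrMr // mul1r; exact: Dmn_le.
rewrite KZ //; last 2 first.
- by rewrite mulr_ge0 // invr_ge0 ltW.
- by move=> w; rewrite lee_fin exprn_ge0 //; case/andP: Dr.
rewrite K_pow // -EFinM; congr EFin.
rewrite (@geo_Dmn _ p p_gt0 p_le1 k (m + k).+1); last lia.
rewrite exprS [_.-1]/=; field.
by rewrite !lt0r_neq0.
Qed.

Lemma Eb_once k n : (k < n)%N ->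
  Eb p n 0 (fun t => (ups (head [::] (low k.+1 t)) == 1%N)%:R%:E) = ((Dmn p k n)^-1)%:E.
Proof.
move=> kn; have := @Eb_zero k n 0 (fun=> 1) 1%R kn.
rewrite expr0 !mulr1 Eb1 // => <- //; by apply: eq_Eb => t _; rewrite mule1.
Qed.

Definition pat_weight (m n j : nat) : R :=
  (wt p j.+2 (pat2 n) * (wt p j.+1 (pat1 m n) * wt p j (pat0 m)))%R.

Lemma pat_weight_ge0 m n j : (0 <= pat_weight m n j)%R.
Proof. by rewrite !mulr_ge0 // wt_ge0. Qed.

Lemma Eb_pattern_top m n j H c : (forall t, 0 <= H t) -> (0 <= c)%R ->
  Eb p j 0 H = c%:E ->
  Eb p j.+3 0 (fun t => (take 3 t == [:: pat2 n; pat1 m n; pat0 m])%:R%:E * H (drop 3 t))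
  = (pat_weight m n j * c)%:E.
Proof.
move=> H0 c0 EH.
have E w2 : Wset 1 w2 ->
    K p j.+1 (downs w2).+1 (fun w1 => K p j (downs w1).+1 (fun w0 => Eb p j (downs w0)
    (fun t => (take 3 (w2 :: w1 :: w0 :: t) == [:: pat2 n; pat1 m n; pat0 m])%:R%:E *
      H (drop 3 [:: w2, w1, w0 & t]))))
  = (w2 == pat2 n)%:R%:E * (wt p j.+1 (pat1 m n) * (wt p j (pat0 m) * c))%:E.
  move=> Ww2; have [->|ne] := eqVneq w2 (pat2 n); last first.
    rewrite mul0e; apply: esum1 => w1 _; rewrite [X in _ * X]esum1 ?mule0 // => w0 _.
    rewrite (eq_Eb (fun t => 0%:E * 0)) ?EbZ ?mul0e ?mule0 // => t st.
    by rewrite eqseq_cons (negbTE ne) !mul0e.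
  rewrite mul1e downs_pat2.
  rewrite (eq_K (fun w1 => (w1 == pat1 m n)%:R%:E * (wt p j (pat0 m) * c)%:E)).
    rewrite K_pin //; first by exact: Wset_pat1.
    by rewrite lee_fin mulr_ge0 // wt_ge0.
  move=> w1 _; have [->|ne] := eqVneq w1 (pat1 m n); last first.
    rewrite mul0e; apply: esum1 => w0 _.
    rewrite (eq_Eb (fun t => 0%:E * 0)) ?EbZ ?mul0e ?mule0 // => t st.
    by rewrite !eqseq_cons (negbTE ne) andbF !mul0e.
  rewrite mul1e downs_pat1.
  rewrite (eq_K (fun w0 => (w0 == pat0 m)%:R%:E * c%:E)).
    by rewrite K_pin //; exact: Wset_nseq.
  move=> w0 _; have [->|ne] := eqVneq w0 (pat0 m); last first.
    rewrite mul0e (eq_Eb (fun t => 0%:E * 0)) ?EbZ ?mul0e ?mule0 // => t st.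
    by rewrite !eqseq_cons (negbTE ne) !andbF !mul0e.
  rewrite mul1e downs_pat0 -EH; apply: eq_Eb => t st.
  by rewrite /= take0 drop0 eqxx mul1e.
etransitivity; first exact: (@eq_K _ p j.+2 1 _ _ E).
rewrite K_pin //; first by rewrite -EFinM /pat_weight; congr EFin; ring.
- exact: Wset_pat2.
- by rewrite lee_fin !mulr_ge0 // wt_ge0.
Qed.

(** A single up letter at [j + 2] is a renewal, which costs the factor 1 / D(j + 2, N). The three
    prescribed words end without a down letter at [j], so below [j] everything starts afresh. *)
Lemma Eb_pattern m n j N H c : (j.+3 <= N)%N -> (forall t, 0 <= H t) -> (0 <= c)%R ->
  Eb p j 0 H = c%:E ->
  Eb p N 0 (fun t => (pattern m n j t)%:R%:E * H (low j t))
  = (pat_weight m n j * c / Dmn p j.+2 N)%:E.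
Proof.
move=> jN H0 c0 EH.
have E := Eb_pattern_top m n H0 c0 EH.
pose G t := (take 3 t == [:: pat2 n; pat1 m n; pat0 m])%:R%:E * H (drop 3 t).
have G0 t : 0 <= G t by rewrite mule_ge0 // lee_fin ler0n.
have := @Eb_zero j.+2 N 0 G _ jN G0 (mulr_ge0 (pat_weight_ge0 m n j) c0) E.
rewrite expr0 mulr1 mulrC => <-; apply: eq_Eb => t st.
rewrite /pattern /G.
have -> : drop 3 (low j.+3 t) = low j t.
  rewrite -(@low_low j j.+3 t) ?st //; last lia.
  by rewrite [RHS]/low size_low ?st //; congr drop; lia.
case: eqP => [e|_]; last by rewrite !mul0e ?mule0.
rewrite (_ : head [::] (low j.+3 t) = pat2 n).
  by rewrite (proj1 (Wset_pat2 n)) !mul1e.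
by move: e; case: (low j.+3 t) => //= w s [].
Qed.

Lemma Eb_pattern1 m n j N : (j.+3 <= N)%N ->
  Eb p N 0 (fun t => (pattern m n j t)%:R%:E) = (pat_weight m n j / Dmn p j.+2 N)%:E.
Proof.
move=> jN; rewrite -[pat_weight _ _ _]mulr1.
rewrite -(@Eb_pattern m n j N (fun=> 1) 1%R) ?Eb1 //.
by apply: eq_Eb => t _; rewrite mule1.
Qed.

(** For [i + 3 <= j] the pattern at [i] lies in the words below [j], so [Eb_pattern] can take it as
    its functional [H]. *)
Lemma Eb_pattern2 m n i j N : (i.+3 <= j)%N -> (j.+3 <= N)%N ->
  Eb p N 0 (fun t => (pattern m n i t && pattern m n j t)%:R%:E) =
  (pat_weight m n j * (pat_weight m n i / Dmn p i.+2 j) / Dmn p j.+2 N)%:E.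
Proof.
move=> ij jN.
rewrite -(@Eb_pattern m n j N (fun t => (pattern m n i t)%:R%:E)) //.
- apply: eq_Eb => t st; rewrite andbC -EFinM -natrM mulnb; congr (_%:R%:E).
  by rewrite /pattern [in RHS]low_low // st; lia.
- by rewrite divr_ge0 ?pat_weight_ge0 // Dmn_ge0.
- exact: Eb_pattern1.
Qed.

End Renewal.

(** * A union bound over countable covers *)

Section CountableCover.
Context {d : measure_display} {Omega : measurableType d} {R : realType}.
Variable P : probability Omega R.
Local Open Scope ereal_scope.

Lemma probability_le (A B : set Omega) : measurable A -> measurable B ->
  A `<=` B -> P A <= P B.
Proof. by move=> mA mB AB; apply: le_measure => //; rewrite inE. Qed.

Lemma countable_cover_le (T : countType) (D : set T) (E : set Omega)
  (B : T -> set Omega) (f : T -> \bar R) :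
  measurable E -> (forall t, measurable (B t)) -> E `<=` \bigcup_(t in D) B t ->
  (forall t, 0 <= f t) -> (forall t, D t -> P (B t) <= f t) ->
  P E <= \esum_(t in D) f t.
Proof.
move=> mE mB EB f0 PB.
(* The cover is enumerated through [pickle]; numbers that encode no element of [D] receive the empty
   set. *)
pose F i := if pickle_inv i is Some t then if `[< D t >] then B t else set0 else set0.
have mF i : measurable (F i).
  by rewrite /F; case: (pickle_inv i) => [t|//]; case: ifP => _ //; exact: mB.
have EF : E `<=` \bigcup_i F i.
  move=> w /EB[t Dt Bt]; exists (pickle t) => //; rewrite /F pickleK_inv.
  by case: asboolP.
apply: le_trans; first exact: (measure_sigma_subadditive P mF mE EF).
pose g i := if pickle_inv i is Some s then f s else 0.
have g0 i : 0 <= g i by rewrite /g; case: (pickle_inv i).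
rewrite nneseries_esumT //.
rewrite (eq_esum (b := fun t => g (pickle t))); last by move=> t _; rewrite /g pickleK_inv.
rewrite -(@esum_image _ _ _ D pickle g); last first.
  by move=> s t _ _; exact: (pcan_inj pickleK).
rewrite [leRHS]esum_mkcond; apply: le_esum => i _; rewrite /F.
case e : (pickle_inv i) => [t|]; last by rewrite measure0; case: ifP.
case: asboolP => Dt; last by rewrite measure0; case: ifP.
have <- : pickle t = i by have := @pickle_invK T i; rewrite e.
by rewrite mem_set /g ?pickleK_inv; [exact: PB|exists t].
Qed.

End CountableCover.

(** * Path events of the chain *)

Definition agree (n : nat) (Y Y' : nat -> nat) := forall i, (i <= n)%N -> Y i = Y' i.

Lemma word_agree n Y Y' x T : (T <= n)%N -> agree n Y Y' -> word Y x T = word Y' x T.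
Proof.
move=> + YY'; elim: T => // T IH Tn; rewrite !wordS IH ?(ltnW Tn) //.
by rewrite !YY' // ltnW.
Qed.

Lemma words_agree n Y Y' T m : (T <= n)%N -> agree n Y Y' -> words Y T m = words Y' T m.
Proof. by move=> Tn YY'; elim: m => //= m ->; rewrite (word_agree _ Tn YY'). Qed.

Lemma first_hit_agree n Y Y' N T : (T <= n)%N -> agree n Y Y' ->
  first_hit Y N T -> first_hit Y' N T.
Proof.
move=> Tn YY' [YT h]; split; first by rewrite -YY'.
by move=> i iT; rewrite -YY'; [exact: h|apply: ltnW; exact: leq_trans Tn].
Qed.

Section Chain.
Context {R : realType} {d : measure_display} {Omega : measurableType d}.
Variables (P : probability Omega R) (p : nat -> R) (X : Omega -> nat -> nat).
Hypothesis p0 : p 0%N = 1.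
Hypothesis p_gt0 : forall x, 0 < p x.
Hypothesis p_le1 : forall x, p x <= 1.
Hypothesis hX : is_chain P p X.
Local Open Scope ereal_scope.

Definition cyl (n : nat) (s : nat -> nat) : set Omega := [set w | agree n (X w) s].

Lemma measurable_cyl n s : measurable (cyl n s).
Proof.
have -> : cyl n s = \bigcap_(i in [set i | (i <= n)%N]) [set w | X w i = s i].
  by apply/seteqP; split=> w.
by apply: bigcap_measurableType => i _; case: hX.
Qed.

Definition cyl_weight (n : nat) (s : nat -> nat) : R :=
  ((s 0%N == 0%N)%:R * \prod_(i < n) trans p (s i) (s i.+1))%R.

Lemma trans_ge0 x y : (0 <= trans p x y)%R.
Proof. by rewrite /trans; do 2?[case: ifP => _] => //; rewrite ?subr_ge0 // ltW. Qed.

Lemma cyl_weight_ge0 n s : (0 <= cyl_weight n s)%R.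
Proof. by rewrite mulr_ge0 ?ler0n // prodr_ge0 // => i _; exact: trans_ge0. Qed.

Lemma P_cyl n s : P (cyl n s) = (cyl_weight n s)%:E.
Proof. exact: (proj2 hX). Qed.

Lemma cyl_cover n w : exists s : seq nat, cyl n (nth 0%N s) w.
Proof.
exists (mkseq (X w) n.+1) => i ile.
by rewrite nth_mkseq.
Qed.

(** The event is a union of cylinders indexed by finite sequences, of which there are only countably
    many. *)
Lemma measurable_horizon n (A : (nat -> nat) -> Prop) :
  (forall Y Y', agree n Y Y' -> A Y -> A Y') -> measurable [set w | A (X w)].
Proof.
move=> hA.
have -> : [set w | A (X w)] = \bigcup_(s : seq nat)
    (if `[< A (nth 0%N s) >] then cyl n (nth 0%N s) else set0).
  apply/seteqP; split=> [w Aw|w [s _]] /=.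
    have [s hs] := cyl_cover n w; exists s => //.
    by case: asboolP => // -[]; exact: hA Aw.
  by case: asboolP => // As hs; apply: hA As => i ile; rewrite hs.
apply: countable_bigcupT_measurable; first exact: countableP.
by move=> s; case: ifP => _ //; exact: measurable_cyl.
Qed.

Lemma null_horizon n (A : (nat -> nat) -> Prop) :
  (forall Y Y', agree n Y Y' -> A Y -> A Y') ->
  (forall s, A s -> cyl_weight n s = 0%R) -> P [set w | A (X w)] = 0.
Proof.
move=> hA h; apply/eqP; rewrite eq_le measure_ge0 andbT.
rewrite -(@esum1 R _ [set s : seq nat | A (nth 0%N s)] (fun=> 0)) //.
apply: (countable_cover_le (B := fun s => cyl n (nth 0%N s))) => //.
- exact: measurable_horizon hA.
- by move=> s; exact: measurable_cyl.
- move=> w Aw; have [s hs] := cyl_cover n w; exists s => //=.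
  exact: hA Aw.
- by move=> s As; rewrite P_cyl h.
Qed.

Definition nn_set : set Omega := [set w | nnpath (X w)].

Lemma nn_setE : nn_set = [set w | X w 0%N = 0%N] `&`
  \bigcap_i [set w | X w i.+1 = (X w i).+1 \/ (X w i.+1).+1 = X w i].
Proof. by apply/seteqP; split => w [h1 h2]; split=> // i; [move=> _|]; exact: h2. Qed.

Lemma measurable_nn : measurable nn_set.
Proof.
rewrite nn_setE; apply: measurableI.
  by apply: (measurable_horizon (n := 0) (A := fun Y => Y 0%N = 0%N)) => Y Y' YY' e; rewrite -YY'.
apply: bigcap_measurableType => i _.
apply: (measurable_horizon (n := i.+1)
  (A := fun Y => Y i.+1 = (Y i).+1 \/ (Y i.+1).+1 = Y i)) => Y Y' YY'.
by rewrite !YY'.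
Qed.

Lemma nn_ae : P.-negligible (~` nn_set).
Proof.
rewrite nn_setE setCI setC_bigcap; apply: negligibleU.
  apply/negligibleP; first apply: measurableC.
    by apply: (measurable_horizon (n := 0) (A := fun Y => Y 0%N = 0%N)) => Y Y' YY' e; rewrite -YY'.
  apply: (null_horizon (n := 0) (A := fun Y => Y 0%N <> 0%N)) => [Y Y' YY'|s /eqP].
    by rewrite YY'.
  by rewrite /cyl_weight => /negbTE ->; rewrite mul0r.
apply: negligible_bigcup => i.
pose A (Y : nat -> nat) := ~ (Y i.+1 = (Y i).+1 \/ (Y i.+1).+1 = Y i).
have hA Y Y' : agree i.+1 Y Y' -> A Y -> A Y' by move=> YY'; rewrite /A !YY'.
have mA := measurable_horizon hA.
rewrite (_ : ~` _ = [set w | A (X w)]) //.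
apply/negligibleP => //; apply: (null_horizon hA) => s As.
rewrite /cyl_weight big_ord_recr /= /trans.
case: (s i.+1 =P (s i).+1) => [e|_]; first by exfalso; apply: As; left.
case: ((s i.+1).+1 =P s i) => [e|_]; first by exfalso; apply: As; right.
by rewrite !mulr0.
Qed.

(** The probability of staying below [N] for [n] steps from [x < N]. At [x = 0] the truncated
    predecessor [0.-1 = 0] is harmless since [p 0 = 1]. *)
Fixpoint stay (N n x : nat) : R :=
  if n is m.+1 then
    ((if (x.+1 < N)%N then p x * stay N m x.+1 else 0) + (1 - p x) * stay N m x.-1)%R
  else 1%R.

Definition upd (s : nat -> nat) (m y : nat) : nat -> nat :=
  fun i => if i == m then y else s i.

Lemma cyl_weightS m s y :
  cyl_weight m.+1 (upd s m.+1 y) = (cyl_weight m s * trans p (s m) y)%R.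
Proof.
rewrite /cyl_weight big_ord_recr /= mulrA /upd eqxx (ltn_eqF (ltnSn m)).
congr (_ * _ * _)%R; apply: eq_bigr => i _.
by rewrite ltn_eqF ?ltnS ?(ltnW (ltn_ord i)) // ltn_eqF // ltnS ltn_ord.
Qed.

Definition stay_event (N m n : nat) (s : nat -> nat) : set Omega :=
  nn_set `&` [set w | agree m (X w) s /\
                      forall i, (m <= i <= m + n)%N -> (X w i < N)%N].

Lemma measurable_stay_event N m n s : measurable (stay_event N m n s).
Proof.
apply: measurableI; first exact: measurable_nn.
apply: (measurable_horizon (n := (m + n)%N) (A := fun Y => agree m Y s /\
  forall i, (m <= i <= m + n)%N -> (Y i < N)%N)) => Y Y' YY' [h1 h2]; split.
  by move=> i im; rewrite -YY' ?h1 // (leq_trans im) // leq_addr.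
by move=> i /[dup] /andP[_ ile] h; rewrite -YY' // h2.
Qed.

Lemma stay_ge0 N n x : (0 <= stay N n x)%R.
Proof.
elim: n x => //= n IH x; rewrite addr_ge0 ?mulr_ge0 ?subr_ge0 //.
by case: ifP => _ //; rewrite mulr_ge0 // ltW.
Qed.

Lemma P_stay_event N m n s : P (stay_event N m n s) <= (cyl_weight m s * stay N n (s m))%:E.
Proof.
elim: n m s => [|n IH] m s.
  rewrite /= mulr1 -P_cyl; apply: probability_le.
  - exact: measurable_stay_event.
  - exact: measurable_cyl.
  - by move=> w [_ []].
(* The step at time [m] goes up or down, which splits the event into two of the same kind at time
   [m + 1]. *)
pose up := stay_event N m.+1 n (upd s m.+1 (s m).+1).
pose dn := stay_event N m.+1 n (upd s m.+1 (s m).-1).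
have aup w y : agree m (X w) s -> X w m.+1 = y -> agree m.+1 (X w) (upd s m.+1 y).
  move=> h1 e i; rewrite leq_eqVlt => /orP[/eqP ->|im]; first by rewrite /upd eqxx.
  by rewrite /upd ltn_eqF // h1.
have mup : measurable up by apply: measurable_stay_event.
have mdn : measurable dn by apply: measurable_stay_event.
pose up' := if ((s m).+1 < N)%N then up else set0.
pose dn' := if (0 < s m)%N then dn else set0.
have mup' : measurable up' by rewrite /up'; case: ifP.
have mdn' : measurable dn' by rewrite /dn'; case: ifP.
apply: (@le_trans _ _ (P (up' `|` dn'))).
  apply: probability_le; [exact: measurable_stay_event|exact: measurableU|].
  move=> w [nw [h1 h2]].
  have h2' i : (m.+1 <= i <= m.+1 + n)%N -> (X w i < N)%N by move=> h; apply: h2; lia.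
  have wm := h1 _ (leqnn m).
  case: (proj2 nw m); rewrite wm => e.
    left; rewrite /up'; case: ifPn => [_|/negP h].
      by split => //; split => //; exact: aup.
    by case: h; rewrite -e; apply: h2; lia.
  right; rewrite /dn' -e /=; split => //; split => //; apply: aup => //.
  by rewrite -e.
apply: le_trans; first exact: measureU2.
rewrite /= mulrDr EFinD; apply: leeD.
  rewrite /up'; case: ifP => _; last by rewrite measure0 mulr0.
  apply: (le_trans (IH _ _)); rewrite cyl_weightS /trans eqxx /upd eqxx mulrA //.
rewrite /dn'; case: ifP => sm; last first.
  rewrite measure0 lee_fin mulr_ge0 ?cyl_weight_ge0 // mulr_ge0 ?stay_ge0 //.
  by rewrite subr_ge0.
apply: (le_trans (IH _ _)); rewrite cyl_weightS /trans /upd eqxx.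
rewrite (prednK sm) eqxx (_ : _ == _ = false) ?mulrA //; lia.
Qed.

(* [pot N x] is the expected time to reach [N] from [x]. *)
Fixpoint pot_diff (x : nat) : R :=
  if x is y.+1 then ((1 + (1 - p x) * pot_diff y) / p x)%R else 1%R.

Definition pot (N x : nat) : R := (\sum_(x <= y < N) pot_diff y)%R.

(** The left side is a truncated mean of the hitting time. [pot] solves the first-step equation of
    the mean exactly, so induction on [k] bounds every truncation. *)
Lemma sum_stay_le N k x : (x < N)%N -> (\sum_(i < k) stay N i x <= pot N x)%R.
Proof.
have pd0 y : (0 <= pot_diff y)%R.
  elim: y => //= y IH; rewrite divr_ge0 ?(ltW (p_gt0 _)) // addr_ge0 // mulr_ge0 //.
  by rewrite subr_ge0.
elim: k x => [|k IH] x xN.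
  by rewrite big_ord0 sumr_ge0.
rewrite big_ord_recl /=.
have h1 : (\sum_(i < k) (if (x.+1 < N)%N then p x * stay N i x.+1 else 0) <= p x * pot N x.+1)%R.
  have [xN1|xN1] := ltnP x.+1 N.
    by rewrite -mulr_sumr ler_pM2l // IH.
  by rewrite big1 // mulr_ge0 ?(ltW (p_gt0 _)) // sumr_ge0.
have h2 : (\sum_(i < k) stay N i x.-1 <= pot N x.-1)%R by apply: IH; lia.
rewrite big_split /= -mulr_sumr.
have q0 : (0 <= 1 - p x)%R by rewrite subr_ge0.
have h3 : (pot N x = pot_diff x + pot N x.+1)%R by rewrite /pot big_ltn.
have h4 := ler_wpM2l q0 h2.
case: x xN h1 h2 q0 h3 h4 => [|x] xN h1 h2 q0 h3 h4.
  rewrite h3 p0 subrr mul0r addr0 /=; move: h1; rewrite p0 mul1r; lra.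
have h5 : (pot N x = pot_diff x + pot N x.+1)%R by rewrite /pot big_ltn // ltnW.
have h6 : (p x.+1 * pot_diff x.+1 = 1 + (1 - p x.+1) * pot_diff x)%R.
  by rewrite /= mulrCA divff ?lt0r_neq0 // mulr1.
move: h1 h4; rewrite /= h5 h3; nra.
Qed.

(** For positive [N] the probability of never hitting [N] is below every survival probability. If it
    were positive, the sum of these would exceed the bound [pot]. *)
Lemma hit_ae N : P.-negligible (nn_set `&` [set w | forall t, X w t <> N]).
Proof.
have mN : measurable [set w | forall t, X w t <> N].
  have -> : [set w | forall t, X w t <> N] = \bigcap_t ~` [set w | X w t = N].
    by apply/seteqP; split => w h t => [_|]; exact: h.
  by apply: bigcap_measurableType => t _; apply: measurableC; case: hX.
have mE := measurableI _ _ measurable_nn mN.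
set E := _ `&` _.
case: N @E mN mE => [|N] E mN mE.
  rewrite (_ : E = set0); first exact: negligible_set0.
  by rewrite -subset0 => w [[w0 _] /(_ 0%N)].
apply/negligibleP => //; suff : P E = 0 by [].
have le_n n : P E <= (stay N.+1 n 0)%:E.
  apply: (@le_trans _ _ (P (stay_event N.+1 0 n (fun=> 0%N)))).
    apply: probability_le => //; first exact: measurable_stay_event.
    move=> w [nw h]; split => //; split.
      by move=> i; rewrite leqn0 => /eqP ->; case: nw.
    move=> i _; rewrite ltnNge; apply/negP => /(nnpath_cross nw)[j _].
    exact: h.
  apply: (le_trans (P_stay_event _ _ _ _)).
  by rewrite /cyl_weight eqxx big_ord0 !mul1r.
have PEf : P E \is a fin_num by apply: fin_num_measure.
have PE0 : 0 <= P E by [].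
move: le_n PE0; rewrite -(fineK PEf); set e := fine (P E) => le_n; rewrite lee_fin => e0.
suff -> : e = 0%R by []; apply/eqP; rewrite eq_le e0 andbT leNgt; apply/negP => ep.
have [k hk] : exists k : nat, (pot N.+1 0 / e < k%:R)%R.
  by exists (Num.truncn (pot N.+1 0 / e)).+1; exact: truncnS_gt.
have := sum_stay_le k (ltn0Sn N); apply/negP; rewrite -ltNge.
rewrite ltr_pdivrMr // in hk; apply: lt_le_trans hk _.
have -> : (k%:R * e = \sum_(i < k) e)%R by rewrite sumr_const card_ord mulr_natl.
by apply: ler_sum => i _; rewrite -lee_fin.
Qed.

Definition good : set Omega :=
  nn_set `&` [set w | forall N, exists t, X w t = N].

Lemma measurable_good : measurable good.
Proof.
apply: measurableI; first exact: measurable_nn.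
have -> : [set w | forall N, exists t, X w t = N] =
    \bigcap_N \bigcup_t [set w | X w t = N].
  apply/seteqP; split => w h N => [_|]; first by have [t ?] := h N; exists t.
  by have [t _ ?] := h N I; exists t.
apply: bigcap_measurableType => N _; apply: bigcup_measurable => t _; by case: hX.
Qed.

Lemma good_ae : P.-negligible (~` good).
Proof.
apply: (@negligibleS _ _ _ _ (~` nn_set `|` \bigcup_N (nn_set `&` [set w | forall t, X w t <> N]))).
  move=> w ng; have [nw|] := pselect (nn_set w); last by left.
  right; apply: contrapT => h; apply: ng; split => // N.
  apply: contrapT => /forallNP h'; apply: h; exists N => //.
apply: negligibleU; first exact: nn_ae.
by apply: negligible_bigcup; exact: hit_ae.
Qed.

Lemma good_hit w N : good w -> exists T, first_hit (X w) N T.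
Proof. by move=> [_ /(_ N)[t]]; exact: first_hit_exists. Qed.

(** Interpolates between prescribing all words ([n = 0]) and an arbitrary condition on them
    ([n = N]), so that its probability can be bounded by induction on [n]. *)
Definition words_event (N n : nat) (v : nat -> seq bool) (A : pred (seq (seq bool))) :
    set Omega :=
  good `&` [set w | exists T, [/\ first_hit (X w) N T,
    (forall x, (n <= x < N)%N -> word (X w) x T = v x) & A (words (X w) T n)]].

Lemma measurable_words_event N n v A : measurable (words_event N n v A).
Proof.
apply: measurableI; first exact: measurable_good.
have -> : [set w | exists T, [/\ first_hit (X w) N T,
    (forall x, (n <= x < N)%N -> word (X w) x T = v x) & A (words (X w) T n)]] =
  \bigcup_T [set w | [/\ first_hit (X w) N T,
    (forall x, (n <= x < N)%N -> word (X w) x T = v x) & A (words (X w) T n)]].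
  by apply/seteqP; split => [w [T h]|w [T _ h]]; exists T.
apply: bigcup_measurable => T _.
apply: (measurable_horizon (n := T) (A := fun Y => [/\ first_hit Y N T,
    (forall x, (n <= x < N)%N -> word Y x T = v x) & A (words Y T n)])).
move=> Y Y' YY' [h1 h2 h3]; split.
- exact: (first_hit_agree (leqnn T) YY' h1).
- by move=> x xN; rewrite -(word_agree _ (leqnn T) YY') h2.
- by rewrite -(words_agree _ (leqnn T) YY').
Qed.

(** For [n = 0] the words determine the path, so the event lies in one cylinder. The step to [n + 1]
    is a union bound over the word at [n], which the crossing balance confines to one [Wset]. *)
Lemma P_words_event N n v A : (n <= N)%N ->
  P (words_event N n v A) <= (\prod_(n <= x < N) wt p x (v x))%:E *
     Eb p n (if (n < N)%N then downs (v n) else 0%N) (fun t => (A t)%:R%:E).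
Proof.
have i0 (B : pred (seq (seq bool))) t : 0 <= (B t)%:R%:E :> \bar R by rewrite lee_fin ler0n.
have pr0 k u : (0 <= \prod_(k <= x < N) wt p x (u x))%R.
  by apply: prodr_ge0 => x _; exact: wt_ge0.
elim: n v A => [|n IH] v A nN.
  have [->|/set0P[w0 [g0 [T0 [hT0 v0 A0]]]]] := eqVneq (words_event N 0 v A) set0.
    by rewrite measure0 mule_ge0 // lee_fin.
  rewrite [Eb _ _ _ _]/= (_ : A [::]) // mule1.
  apply: (@le_trans _ _ (P (cyl T0 (X w0)))).
    apply: probability_le; [exact: measurable_words_event|exact: measurable_cyl|].
    move=> w [g [T [hT vw Aw]]] i iT0; apply/esym.
    apply: (words_inj (proj1 g0) (proj1 g) hT0 hT) => // x xN.
    by rewrite v0 // vw.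
  rewrite P_cyl /cyl_weight (proj1 (proj1 g0)) eqxx mul1r.
  rewrite (@prod_trans_wt _ p _ N _ (proj1 g0)); last first.
    by move=> i iT; exact: (first_hit_lt (proj1 g0) hT0 iT).
  rewrite big_mkord lee_fin le_eqVlt; apply/orP; left; apply/eqP.
  by apply: eq_bigr => x _; rewrite v0 //= ltn_ord.
(* If [n + 1 = N] there is no word above, and the first hit of [N] forces a single up letter at [n]:
   this is the value [0]. *)
set z := if _ then _ else _.
pose vv u x := if x == n then u else v x.
pose B u := words_event N n (vv u) (fun t => A (u :: t)).
have : P (words_event N n.+1 v A) <= \esum_(u in Wset z.+1)
    ((\prod_(n.+1 <= x < N) wt p x (v x))%:E * ((wt p n u)%:E *
     Eb p n (downs u) (fun t => (A (u :: t))%:R%:E))).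
  apply: (countable_cover_le (B := B)).
  - exact: measurable_words_event.
  - by move=> u; exact: measurable_words_event.
  - move=> w [g [T [hT vw Aw]]]; exists (word (X w) n T); last first.
      split => //; exists T; split => // x /andP[nx xN]; rewrite /vv.
      by case: eqP => [->//|ne]; apply: vw; rewrite xN andbT ltn_neqAle nx andbT; apply/eqP => /esym.
    rewrite /z; case: ifPn => [n1N|].
      rewrite -vw ?leqnn //; exact: (word_next (proj1 g) hT).
    rewrite -leqNgt => Nn; have eN : N = n.+1 by apply/eqP; rewrite eqn_leq Nn.
    by rewrite eN in hT; exact: (word_top (proj1 g) hT).
  - move=> u; rewrite mule_ge0 ?lee_fin // mule_ge0 ?lee_fin ?wt_ge0 //.
    exact: Eb_ge0.
  - move=> u Wu; apply: (le_trans (IH _ _ (ltnW nN))).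
    have e : vv u n = u by rewrite /vv eqxx.
    have e' : (\prod_(n.+1 <= x < N) wt p x (vv u x) = \prod_(n.+1 <= x < N) wt p x (v x))%R.
      by apply: eq_big_nat => x /andP[nx _]; rewrite /vv gtn_eqF.
    by rewrite nN (big_ltn nN) e e' muleA -EFinM mulrC.
rewrite esumZ //.
by move=> u; rewrite mule_ge0 ?lee_fin ?wt_ge0 //; exact: Eb_ge0.
Qed.

Definition hit_event (N : nat) (A : pred (seq (seq bool))) : set Omega :=
  good `&` [set w | exists2 T, first_hit (X w) N T & A (words (X w) T N)].

Lemma hit_eventE N A : hit_event N A = words_event N N (fun=> [::]) A.
Proof.
apply/seteqP; split => w [g [T]].
  move=> hT Aw; split => //; exists T; split => // x xN; lia.
by move=> [hT _ Aw]; split => //; exists T.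
Qed.

Lemma measurable_hit_event N A : measurable (hit_event N A).
Proof. by rewrite hit_eventE; exact: measurable_words_event. Qed.

Lemma P_hit_event N A : P (hit_event N A) <= Eb p N 0 (fun t => (A t)%:R%:E).
Proof.
rewrite hit_eventE; apply: le_trans; first exact: P_words_event.
by rewrite ltnn big_geq // mul1e.
Qed.

End Chain.

(** * The limits D(k) and dyadic estimates *)

Section DInfinity.
Variables (R : realType) (p : nat -> R).
Hypothesis p_gt0 : forall x, 0 < p x.
Hypothesis p_le1 : forall x, p x <= 1.

Definition Dinv (k : nat) : R := if Dinf p k == +oo%E then 0 else (fine (Dinf p k))^-1.

Lemma Dmn_cvg k : (Dmn p k n)%:E @[n --> \oo] --> Dinf p k.
Proof.
apply: ereal_nondecreasing_is_cvgn => m n mn.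
by rewrite lee_fin; exact: Dmn_le.
Qed.

Lemma Dmn_le_Dinf k n : ((Dmn p k n)%:E <= Dinf p k)%E.
Proof.
apply: (@cvge_to_ge _ _ _ _ _ _ _ (Dmn_cvg (k := k))).
by near=> m; rewrite lee_fin; apply: Dmn_le => //; near: m; exact: nbhs_infty_ge.
Unshelve. all: by end_near. Qed.

Lemma Dinf_fin k : Dinf p k != +oo%E -> Dinf p k = (fine (Dinf p k))%:E.
Proof.
move=> h; rewrite fineK // fin_numE h andbT; apply/eqP => e.
by have := Dmn_le_Dinf k k; rewrite e.
Qed.

Lemma Dinv_cvg k : (Dmn p k n)^-1 @[n --> \oo] --> Dinv k.
Proof.
have D0 : \forall n \near \oo, 0 < Dmn p k n.
  by near=> n; apply: Dmn_gt0 => //; near: n; exact: nbhs_infty_gt.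
rewrite /Dinv; case: eqVneq => [e|ne].
  have := Dmn_cvg (k := k); rewrite e => /cvgeryP h.
  exact/(gtr0_cvgV0 D0).
have h := Dmn_cvg (k := k); rewrite (Dinf_fin ne) in h.
have h1 := Dmn_le_Dinf k k.+1; rewrite (Dinf_fin ne) lee_fin Dmn_diagS in h1.
apply: cvgV; first by rewrite gt_eqF // (lt_le_trans _ h1).
exact: (fine_cvg h).
Unshelve. all: by end_near. Qed.

Lemma Dinv_ge0 k : 0 <= Dinv k.
Proof.
rewrite /Dinv; case: ifP => // _; rewrite invr_ge0 fine_ge0 //.
by apply: le_trans (Dmn_le_Dinf k k); rewrite Dmn_diag.
Qed.

Lemma Dterm_Dinv n : Dterm p n = (Dinv n / ln n%:R)%:E.
Proof. by rewrite /Dterm /Dinv; case: ifP => _; rewrite ?mul0r // invfM. Qed.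

Lemma ln_nat_ge0 n : (0 < n)%N -> 0 <= ln (n%:R : R).
Proof. by move=> n0; rewrite ln_ge0 // ler1n. Qed.

Lemma Dterm_ge0 n : (2 <= n)%N -> (0 <= Dterm p n)%E.
Proof.
by move=> n2; rewrite Dterm_Dinv lee_fin divr_ge0 ?Dinv_ge0 // ln_nat_ge0 // ltnW.
Qed.

Lemma rho_prod_le1 k j : (forall x, (k < x)%N -> rho p x <= 1) -> rho_prod p k j <= 1.
Proof.
move=> h; rewrite /rho_prod big_nat_cond; apply: prodr_ile1 => i /andP[/andP[ki _] _].
by rewrite rho_ge0 //= h.
Qed.

Lemma Dmn_le_sub k n : (forall x, (k < x)%N -> rho p x <= 1) -> (k <= n)%N ->
  Dmn p k n <= (n - k)%:R.
Proof.
move=> h /subnKC <-; rewrite addKn; elim: (n - k)%N => [|m IH].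
  by rewrite addn0 Dmn_diag.
by rewrite addnS DmnS ?leq_addr // -natr1 lerD // rho_prod_le1.
Qed.

End DInfinity.

(** Each doubling of the range adds [2 ^ j] terms of size at least [1 / 2 ^ j.+1], hence at least
    one half. *)
Lemma harmonic_pow2 (R : realType) j :
  (j.+1%:R / 2 : R) <= \sum_(1 <= i < (2 ^ j).+1) (i%:R)^-1.
Proof.
elim: j => [|j IH]; first by rewrite big_nat1 invr1; lra.
rewrite (@big_cat_nat _ _ _ (2 ^ j).+1) //=; last by rewrite ltnS leq_exp2l.
rewrite -natr1 mulrDl lerD //.
apply: (@le_trans _ _ (\sum_((2 ^ j).+1 <= i < (2 ^ j.+1).+1) ((2 ^ j.+1)%:R)^-1)).
  have e : ((2 ^ j.+1).+1 - (2 ^ j).+1 = 2 ^ j)%N by rewrite subSS expnS mul2n -addnn addnK.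
  have nz : (2 ^ j)%:R != 0 :> R by rewrite pnatr_eq0 expn_eq0.
  by rewrite sumr_const_nat e -[_ *+ (2 ^ j)]mulr_natl expnS natrM invfM mulrCA (mulfV nz) mulr1 mul1r.
apply: ler_sum_nat => i /andP[h1 h2].
rewrite lef_pV2 ?posrE ?ltr0n ?expn_gt0 //; last by apply: leq_trans h1.
by rewrite ler_nat -ltnS.
Qed.

Lemma ln_lt_pow2 (R : realType) n j : (0 < n)%N -> (n < 2 ^ j)%N -> ln (n%:R : R) <= j%:R.
Proof.
move=> n0 nj.
have ln2 : ln (2 : R) <= 1 by have := @le_ln1Dx R 1; rewrite -natr1; apply; lra.
apply: (@le_trans _ _ (ln ((2 : R) ^+ j))).
  by rewrite ler_ln ?posrE ?ltr0n ?exprn_gt0 // -natrX ler_nat ltnW.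
by rewrite lnXn // -[ln _ *+ j]mulr_natl ler_piMr.
Qed.

(** * Rightmost sites of a given type *)

Section TypedSites.
Variables (R : realType) (p : nat -> R).
Hypothesis p_gt0 : forall x, 0 < p x.
Hypothesis p_le1 : forall x, p x <= 1.
Variables (typ : pred (seq bool)) (c : R) (N1 : nat).
Hypothesis c_gt0 : 0 < c.
(** Conditioned on its type and on its number of up letters, a word has no down letter with
    probability at least [c]. *)
Hypothesis typ_c : forall n u, (N1 <= n)%N ->
  (c%:E * K p n u.+1 (fun w => (typ w)%:R%:E) <=
   ((typ (nseq u.+1 true))%:R * wt p n (nseq u.+1 true))%:E)%E.
Local Open Scope ereal_scope.

(* In [w :: t] the word [w] belongs to the site [size t]. *)
Fixpoint has_typ (lo hi : nat) (t : seq (seq bool)) : bool :=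
  if t is w :: t' then ((lo <= size t' < hi)%N && typ w) || has_typ lo hi t' else false.

(** The guard excludes sites for which [t] has no word yet, where [low] would return all of [t];
    thus [count_once] can only grow when a word is put on top. *)
Definition once (k : nat) (t : seq (seq bool)) : bool :=
  (k < size t)%N && (ups (head [::] (low k.+1 t)) == 1%N).

Definition count_once (lo hi : nat) (t : seq (seq bool)) : \bar R :=
  \sum_(lo <= k < hi) (once k t)%:R%:E.

Lemma count_once_ge0 lo hi t : 0 <= count_once lo hi t.
Proof. by apply: sume_ge0 => k _; rewrite lee_fin ler0n. Qed.

Lemma count_once_cons lo hi w t : count_once lo hi t <= count_once lo hi (w :: t).
Proof.
apply: lee_sum => k _; rewrite lee_fin ler_nat /once.
case: (ltnP k (size t)) => kt //=.
by rewrite low_cons // leqW.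
Qed.

Lemma Eb_count_once lo hi n : (n <= hi)%N ->
  \sum_(lo <= k < n) ((Dmn p k n)^-1)%:E <= Eb p n 0 (count_once lo hi).
Proof.
move=> nhi; rewrite /count_once Eb_sum //.
have E0 k : 0 <= Eb p n 0 (fun t => (once k t)%:R%:E).
  by apply: Eb_ge0 => // t; rewrite lee_fin ler0n.
have [lon|/ltnW lon] := leqP lo n; last by rewrite (big_geq lon) sume_ge0.
rewrite (big_cat_nat lon nhi) /=.
apply: (@le_trans _ _ (\sum_(lo <= k < n) Eb p n 0 (fun t => (once k t)%:R%:E))).
  rewrite big_nat_cond [leRHS]big_nat_cond; apply: lee_sum => k /andP[/andP[lok kn] _].
  rewrite -Eb_once //; apply: le_Eb => // t st.
  by rewrite /once st kn.
by rewrite leeDl // sume_ge0.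
Qed.

Lemma Eb_count_once_eq lo hi N : (hi <= N)%N ->
  Eb p N 0 (count_once lo hi) = (\sum_(lo <= k < hi) (Dmn p k N)^-1)%R%:E.
Proof.
move=> hiN; rewrite /count_once Eb_sum //.
rewrite -sumEFin; apply: eq_big_nat => k /andP[_ khi].
have kN : (k < N)%N by apply: leq_trans hiN.
by rewrite -Eb_once //; apply: eq_Eb => t st; rewrite /once st kN.
Qed.

(* Scan the words downwards from the top. At the first site [n] of the given
   type, with probability at least [c] there is no down letter, and the words
   below then contain at least [h] once-crossed edges on average. *)
Lemma Eb_has_typ_le lo' lo hi h n z : (N1 <= lo)%N -> (0 <= h)%R ->
  (forall n, (lo <= n < hi)%N -> h%:E <= Eb p n 0 (count_once lo' hi)) ->
  (c * h)%:E * Eb p n z (fun t => (has_typ lo hi t)%:R%:E) <=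
  Eb p n z (count_once lo' hi).
Proof.
move=> N1lo h0 hh.
have ch0 : (0 <= c * h)%R by rewrite mulr_ge0 // ltW.
have i0 (b : bool) : 0 <= b%:R%:E :> \bar R by rewrite lee_fin ler0n.
elim: n z => [|n IH] z; first by rewrite /= mule0 count_once_ge0.
rewrite !EbS.
pose g w := Eb p n (downs w) (count_once lo' hi).
have g0 w : 0 <= g w by apply: Eb_ge0 => // t; exact: count_once_ge0.
apply: (@le_trans _ _ (K p n z.+1 g)); last first.
  by apply: le_K => // w _; apply: le_Eb => // t _; exact: count_once_cons.
have [/andP[lon nhi]|out] := boolP (lo <= n < hi)%N; last first.
  rewrite -KZ //; last by move=> w; apply: Eb_ge0.
  apply: le_K => // w _; rewrite (eq_Eb (fun t => (has_typ lo hi t)%:R%:E)) ?IH //.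
  by move=> t st; rewrite /= st (negbTE out).
have hT : K p n z.+1 (fun w => Eb p n (downs w) (fun t => (has_typ lo hi (w :: t))%:R%:E)) <=
    K p n z.+1 (fun w => (typ w)%:R%:E) +
    K p n z.+1 (fun w => (~~ typ w)%:R%:E * Eb p n (downs w) (fun t => (has_typ lo hi t)%:R%:E)).
  rewrite -KD //; last by move=> w; rewrite mule_ge0 // Eb_ge0.
  apply: le_K => // w _.
  have [tw|tw] := boolP (typ w); last first.
    rewrite add0e mul1e; apply: le_Eb => // t st /=.
    by rewrite (negbTE tw) andbF.
  rewrite mul0e adde0; apply: (@le_trans _ _ (Eb p n (downs w) (fun=> 1))); last by rewrite Eb1.
  by apply: le_Eb => // t st; rewrite lee_fin lern1 leq_b1.
apply: (le_trans (lee_wpmul2l _ hT)); first by rewrite lee_fin.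
have -> : K p n z.+1 g = K p n z.+1 (fun w => (typ w)%:R%:E * g w) +
    K p n z.+1 (fun w => (~~ typ w)%:R%:E * g w).
  rewrite -KD //; try by move=> w; rewrite mule_ge0.
  by apply: eq_K => w _; case: (typ w); rewrite ?mul1e ?mul0e ?adde0 ?add0e.
rewrite ge0_muleDr; [|by apply: K_ge0..| by apply: K_ge0 => // w; rewrite mule_ge0 // Eb_ge0].
apply: leeD; last first.
  rewrite -KZ //; last by move=> w; rewrite mule_ge0 // Eb_ge0.
  apply: le_K => // w _; rewrite muleCA; apply: lee_wpmul2l => //; exact: IH.
(* On the typed part only the word without down letters is kept: below it the mean count is at least
   [h], and [typ_c] compares its weight with that of all typed words. *)
apply: (@le_trans _ _ (h%:E * ((typ (nseq z.+1 true))%:R * wt p n (nseq z.+1 true))%:E)).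
  rewrite mulrC EFinM -muleA; apply: lee_wpmul2l; first by rewrite lee_fin.
  by apply: typ_c; exact: leq_trans lon.
apply: le_trans (@K_ge_pin _ _ p_gt0 p_le1 n z.+1 (nseq z.+1 true) _ _ _).
- rewrite muleC mulrC EFinM -muleA; apply: lee_wpmul2l; first by rewrite lee_fin wt_ge0.
  apply: lee_wpmul2l => //.
  by rewrite /g count_nseq mul0n; apply: hh; rewrite lon.
- by move=> w; rewrite mule_ge0.
- exact: Wset_nseq.
Qed.

End TypedSites.

Lemma cvgn_sum (R : realType) (I : Type) (r : seq I) (f : I -> nat -> R) (l : I -> R) :
  (forall i, f i n @[n --> \oo] --> l i) ->
  \sum_(i <- r) f i n @[n --> \oo] --> \sum_(i <- r) l i.
Proof.
move=> h; elim: r => [|i r IH].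
  by under eq_fun do rewrite big_nil; rewrite big_nil; exact: cvg_cst.
by under eq_fun do rewrite big_cons; rewrite big_cons; exact: cvgD.
Qed.

Lemma has_typ_words (typ : pred (seq bool)) Y T n lo hi x : (lo <= x < hi)%N -> (x < n)%N ->
  typ (word Y x T) -> has_typ typ lo hi (words Y T n).
Proof.
move=> xlh; elim: n => // n IH; rewrite ltnS leq_eqVlt => /orP[/eqP <-|xn] tw /=.
  by rewrite size_words xlh tw.
by rewrite IH // orbT.
Qed.

Lemma pow2_block x j0 : (2 ^ j0.+1 <= x)%N ->
  exists2 j, (j0 <= j)%N & (2 ^ j.+1 <= x < 2 ^ j.+2)%N.
Proof.
move=> h; have x0 : (0 < x)%N by apply: leq_trans h; rewrite expn_gt0.
have := trunc_log_bounds (isT : (1 < 2)%N) x0.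
have : (j0.+1 <= trunc_log 2 x)%N by apply: trunc_log_max.
by case: (trunc_log 2 x) => // j; rewrite ltnS => jj hx; exists j.
Qed.

(** * Properties of the words at all late hitting times *)

Section HitLiminf.
Context {R : realType} {d : measure_display} {Omega : measurableType d}.
Variables (P : probability Omega R) (p : nat -> R) (X : Omega -> nat -> nat).
Hypothesis hX : is_chain P p X.

Definition hit_liminf (A : pred (seq (seq bool))) : set Omega :=
  \bigcup_N' \bigcap_(N in [set N | (N' <= N)%N]) hit_event X N A.

Lemma measurable_hit_tail A N' :
  measurable (\bigcap_(N in [set N | (N' <= N)%N]) hit_event X N A).
Proof. by apply: bigcap_measurableType => N _; exact: (measurable_hit_event hX). Qed.

Lemma measurable_hit_liminf A : measurable (hit_liminf A).
Proof. by apply: bigcup_measurable => N' _; exact: measurable_hit_tail. Qed.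

(** The event is an increasing union of tails, and each tail is contained in the [N]-th hitting
    event for every large [N]. *)
Lemma P_hit_liminf A (a : nat -> R) l :
  a n @[n --> \oo] --> l ->
  (\forall N \near \oo, (P (hit_event X N A) <= (a N)%:E)%E) ->
  (P (hit_liminf A) <= l%:E)%E.
Proof.
move=> al Pa.
have tail N' : (P (\bigcap_(N in [set N | (N' <= N)%N]) hit_event X N A) <= l%:E)%E.
  have al' : (a n)%:E @[n --> \oo] --> l%:E by apply: cvg_EFin => //; exact: nearW.
  apply: (cvge_to_ge al'); near=> N.
  apply: (@le_trans _ _ (P (hit_event X N A))); last by near: N.
  apply: probability_le.
  - exact: measurable_hit_tail.
  - exact: (measurable_hit_event hX).
  - by apply: bigcap_inf => /=; near: N; exact: nbhs_infty_ge.
have mono : {homo (fun N' => \bigcap_(N in [set N | (N' <= N)%N]) hit_event X N A) :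
    n m / (n <= m)%N >-> (n <= m)%O}.
  move=> n m nm; apply/subsetPset => w h N /= mN; apply: h => /=; exact: leq_trans mN.
have := nondecreasing_cvg_mu (mu := P) (measurable_hit_tail A) (measurable_hit_liminf A) mono.
by move=> /cvge_to_le; apply; exact: nearW.
Unshelve. all: by end_near. Qed.

End HitLiminf.

(** * Finiteness by dyadic blocks and Borel-Cantelli *)

Section FinitelyMany.
Context {R : realType} {d : measure_display} {Omega : measurableType d}.
Variables (P : probability Omega R) (p : nat -> R) (X : Omega -> nat -> nat).
Hypothesis p0 : p 0%N = 1.
Hypothesis p_gt0 : forall x, 0 < p x.
Hypothesis p_le1 : forall x, p x <= 1.
Hypothesis hX : is_chain P p X.
Variable N0 : nat.
Hypothesis rho_le1 : forall x, (N0 < x)%N -> rho p x <= 1.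
Variables (typ : pred (seq bool)) (c : R) (N1 : nat).
Hypothesis c_gt0 : 0 < c.
Hypothesis typ_c : forall n u, (N1 <= n)%N ->
  (c%:E * K p n u.+1 (fun w => (typ w)%:R%:E) <=
   ((typ (nseq u.+1 true))%:R * wt p n (nseq u.+1 true))%:E)%E.

Definition typ_sites (w : Omega) : set nat :=
  [set x | exists N', forall N, (N' <= N)%N ->
    exists2 T, first_hit (X w) N T & typ (word (X w) x T)].

Definition block_typ (j : nat) := has_typ typ (2 ^ j.+1) (2 ^ j.+2).

(** As [2 ^ j.+1 <= n], the [2 ^ j] edges next below [n] all count. At distance [i = n - k] one has
    D(k, n) <= i because the ratios are at most one, which leaves a harmonic sum. *)
Lemma Eb_block_ge j n : (N0 <= 2 ^ j)%N -> (2 ^ j.+1 <= n < 2 ^ j.+2)%N ->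
  ((j.+1%:R / 2)%:E <= Eb p n 0 (count_once R (2 ^ j) (2 ^ j.+2)))%E.
Proof.
move=> N0j /andP[ln nh].
apply: le_trans (Eb_count_once p_gt0 p_le1 _ (ltnW nh)).
rewrite sumEFin lee_fin; apply: (le_trans (harmonic_pow2 R j)).
have jn : (2 ^ j < n)%N by apply: leq_trans ln; rewrite ltn_exp2l.
have -> : \sum_(2 ^ j <= k < n) (Dmn p k n)^-1 =
    \sum_(1 <= i < (n - 2 ^ j).+1) (Dmn p (n - i) n)^-1.
  have shift (G : nat -> R) :
      \sum_(2 ^ j <= i < n) G i = \sum_(0 <= i < n - 2 ^ j) G (i + 2 ^ j)%N.
    by rewrite -{1}(add0n (2 ^ j)%N) big_addn.
  rewrite big_nat_rev shift.
  rewrite [RHS]big_add1; apply: eq_big_nat => i hi.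
  by rewrite (_ : (2 ^ j + n - (i + 2 ^ j).+1 = n - i.+1)%N) //; lia.
have jjn : (2 ^ j + 2 ^ j <= n)%N by rewrite addnn -mul2n -expnS.
have le1 : ((2 ^ j).+1 <= (n - 2 ^ j).+1)%N by lia.
rewrite [leRHS](@big_cat_nat _ _ _ (2 ^ j).+1) //=.
have V0 i : 0 <= (Dmn p (n - i) n)^-1 by rewrite invr_ge0 Dmn_ge0.
apply: (@le_trans _ _ (\sum_(1 <= i < (2 ^ j).+1) (Dmn p (n - i) n)^-1)); last first.
  by rewrite lerDl sumr_ge0.
apply: ler_sum_nat => i /andP[i1 ij].
have D0 : 0 < Dmn p (n - i) n by apply: Dmn_gt0 => //; lia.
rewrite lef_pV2 ?posrE ?ltr0n //.
have -> : (i%:R = (n - (n - i))%:R :> R) by congr _%:R; lia.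
apply: Dmn_le_sub => //; last lia.
by move=> x hx; apply: rho_le1; lia.
Qed.

Lemma P_block_event j N : (N0 <= 2 ^ j)%N -> (N1 <= 2 ^ j.+1)%N -> (2 ^ j.+2 <= N)%N ->
  (P (hit_event X N (block_typ j)) <=
   ((c * (j.+1%:R / 2))^-1 * \sum_(2 ^ j <= k < 2 ^ j.+2) (Dmn p k N)^-1)%:E)%E.
Proof.
move=> N0j N1j hN.
have h0 : (0 < (j.+1%:R / 2) :> R) by rewrite divr_gt0 ?ltr0n.
have ch0 : 0 < c * (j.+1%:R / 2) by rewrite mulr_gt0.
have := @Eb_has_typ_le _ p p_gt0 p_le1 typ c N1 c_gt0 typ_c (2 ^ j) (2 ^ j.+1) (2 ^ j.+2)
  (j.+1%:R / 2) N 0 N1j (ltW h0) (fun n => @Eb_block_ge j n N0j).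
rewrite Eb_count_once_eq // => H.
have HP := P_hit_event p_gt0 p_le1 hX N (block_typ j).
apply: (le_trans HP).
set e := Eb _ _ _ _ in H *; set x := c * _ in H ch0 *.
have -> : e = ((x^-1)%:E * (x%:E * e))%E.
  by rewrite muleA -EFinM mulVf ?mul1e // lt0r_neq0.
rewrite [leRHS]EFinM.
by apply: lee_wpmul2l => //; rewrite lee_fin invr_ge0 ltW.
Qed.

Lemma P_block_liminf j : (N0 <= 2 ^ j)%N -> (N1 <= 2 ^ j.+1)%N ->
  (P (hit_liminf X (block_typ j)) <=
   ((c * (j.+1%:R / 2))^-1 * \sum_(2 ^ j <= k < 2 ^ j.+2) Dinv p k)%:E)%E.
Proof.
move=> N0j N1j.
apply: (P_hit_liminf hX (a := fun N =>
  (c * (j.+1%:R / 2))^-1 * \sum_(2 ^ j <= k < 2 ^ j.+2) (Dmn p k N)^-1)).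
  apply: cvgM; first exact: cvg_cst.
  by apply: (cvgn_sum (f := fun k N => (Dmn p k N)^-1)) => k; exact: Dinv_cvg.
by near=> N; apply: P_block_event => //; near: N; exact: nbhs_infty_ge.
Unshelve. all: by end_near. Qed.

Let t k : R := Dinv p k / ln k%:R.

(** On the block [ln k <= j + 2 <= 2 * (j + 1)], so that [1 / (j + 1)] may be traded for
    [2 / ln k]. *)
Lemma block_sum_le j : (1 <= j)%N ->
  (c * (j.+1%:R / 2))^-1 * \sum_(2 ^ j <= k < 2 ^ j.+2) Dinv p k <=
  (4 / c) * \sum_(2 ^ j <= k < 2 ^ j.+2) t k.
Proof.
move=> j1; rewrite !mulr_sumr; apply: ler_sum_nat => k /andP[h1 h2].
have k2 : (2 <= k)%N by apply: leq_trans h1; rewrite -{1}(expn1 2) leq_exp2l.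
have ln0 : 0 < ln (k%:R : R) by rewrite ln_gt0 // ltr1n.
have lnk : ln (k%:R : R) <= 2 * j.+1%:R.
  apply: (le_trans (ln_lt_pow2 R (ltnW k2) h2)).
  by rewrite -[2]/(2%:R) -natrM ler_nat; lia.
have j0 : (0 < j.+1%:R :> R) by rewrite ltr0n.
have -> : (c * (j.+1%:R / 2))^-1 = 2 / c * j.+1%:R^-1.
  by field; rewrite !lt0r_neq0.
have -> : 4 / c * t k = 2 / c * (2 / ln k%:R) * Dinv p k.
  by rewrite /t; field; rewrite !lt0r_neq0.
rewrite ler_wpM2r ?Dinv_ge0 // ler_pM2l ?divr_gt0 //.
by rewrite ler_pdivlMr // mulrC ler_pdivrMr.
Qed.

(** The block from [2 ^ j] to [2 ^ j.+2] consists of two dyadic intervals, so each site is counted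
    at most twice. *)
Lemma sum_blocks_le j m : (1 <= j)%N ->
  \sum_(0 <= i < m) \sum_(2 ^ (j + i) <= k < 2 ^ (j + i).+2) t k <=
  2 * \sum_(2 <= k < 2 ^ (j + m).+1) t k.
Proof.
move=> j1.
have t0 k : (2 <= k)%N -> 0 <= t k.
  by move=> k2; rewrite divr_ge0 ?Dinv_ge0 // ln_nat_ge0 // ltnW.
have s0 a b : (2 <= a)%N -> 0 <= \sum_(a <= k < b) t k.
  move=> a2; rewrite big_nat_cond; apply: sumr_ge0 => k /andP[/andP[ak _] _].
  by apply: t0; exact: leq_trans ak.
have p2 i : (2 <= 2 ^ (j + i))%N.
  by rewrite -{1}(expn1 2) leq_exp2l // (leq_trans j1) // leq_addr.
have H a : (2 <= 2 ^ a)%N -> \sum_(0 <= i < m) \sum_(2 ^ (a + i) <= k < 2 ^ (a + i).+1) t k <=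
    \sum_(2 <= k < 2 ^ (a + m)) t k.
  move=> a2; elim: m => [|n IH]; first by rewrite big_geq // s0.
  have e : (2 ^ (a + n) <= 2 ^ (a + n.+1))%N by rewrite leq_exp2l // addnS.
  have e2 : (2 <= 2 ^ (a + n))%N by apply: (leq_trans a2); rewrite leq_exp2l // leq_addr.
  by rewrite big_nat_recr //= [leRHS](big_cat_nat e2 e) /= addnS lerD2r.
have E i : \sum_(2 ^ (j + i) <= k < 2 ^ (j + i).+2) t k =
   \sum_(2 ^ (j + i) <= k < 2 ^ (j + i).+1) t k +
   \sum_(2 ^ (j.+1 + i) <= k < 2 ^ (j.+1 + i).+1) t k.
  by rewrite (@big_cat_nat _ _ _ (2 ^ (j + i).+1)) //= ?leq_exp2l // !addSn.
rewrite (eq_bigr _ (fun i _ => E i)) big_split /= mulr2n mulrDl mul1r lerD //.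
  apply: (le_trans (H j _)); first by have := p2 0%N; rewrite addn0.
  have e : (2 ^ (j + m) <= 2 ^ (j + m).+1)%N by rewrite leq_exp2l.
  by rewrite [leRHS](big_cat_nat (p2 m) e) /= lerDl s0.
apply: (le_trans (H j.+1 _)); first by have := p2 1%N; rewrite addn1.
by rewrite addSn.
Qed.

Lemma finitely_many_typ : (Dseries p < +oo)%E ->
  {ae P, forall w, finite_set (typ_sites w)}.
Proof.
move=> Dfin.
(* Since [i < 2 ^ i], all blocks from [j0] on lie beyond [N0] and [N1]; the successor also gives
   [1 <= j0]. *)
pose j0 := (maxn N0 N1).+1.
have N0j i : (N0 <= 2 ^ (j0 + i))%N.
  by apply: leq_trans (ltnW (ltn_expl _ (isT : (1 < 2)%N))); lia.
have N1j i : (N1 <= 2 ^ (j0 + i).+1)%N.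
  by apply: leq_trans (ltnW (ltn_expl _ (isT : (1 < 2)%N))); lia.
have D0 : (0 <= Dseries p)%E.
  by apply: nneseries_ge0 => n n2 _; exact: Dterm_ge0.
have Df : Dseries p = (fine (Dseries p))%:E by rewrite fineK // ge0_fin_numE.
have part m : \sum_(2 <= k < m) t k <= fine (Dseries p).
  rewrite -lee_fin -Df -sumEFin; under eq_bigr do rewrite /t -Dterm_Dinv.
  by apply: nneseries_lim_ge => n n2 _; exact: Dterm_ge0.
have sumP : (\sum_(0 <= i <oo) P (hit_liminf X (block_typ (j0 + i))) < +oo)%E.
  apply: (@le_lt_trans _ _ ((4 / c) * (2 * fine (Dseries p)))%:E); last exact: ltry.
  apply: lime_le; first by apply: is_cvg_nneseries.
  apply: nearW => m.
  apply: (@le_trans _ _ (\sum_(0 <= i < m)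
    ((4 / c) * \sum_(2 ^ (j0 + i) <= k < 2 ^ (j0 + i).+2) t k)%:E)%E).
    apply: lee_sum => i _; apply: (le_trans (P_block_liminf (N0j i) (N1j i))).
    by rewrite lee_fin block_sum_le.
  rewrite sumEFin lee_fin -mulr_sumr ler_pM2l ?divr_gt0 //.
  apply: (le_trans (sum_blocks_le m _)) => //.
  by rewrite ler_pM2l.
have BC := lim_sup_set_cvg0 (fun i => measurable_hit_liminf hX (block_typ (j0 + i))) sumP.
have mB : measurable (lim_sup_set (fun i => hit_liminf X (block_typ (j0 + i)))).
  by apply: bigcap_measurableType => n _; apply: bigcup_measurable => i _;
     exact: (measurable_hit_liminf hX).
have nB : P.-negligible (lim_sup_set (fun i => hit_liminf X (block_typ (j0 + i)))).
  exact/negligibleP.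
apply: negligibleS (negligibleU (good_ae p0 p_gt0 p_le1 hX) nB) => w /= ninf.
have [gw|] := pselect (good X w); last by left.
right => n _; apply: contrapT => hn; apply: ninf.
(* By contraposition no block from index [n] on contains a typed site; every number from
   [2 ^ (j0 + n).+1] on lies in such a block, so all typed sites are below it. *)
apply: (@sub_finite_set _ _ `I_(2 ^ (j0 + n).+1)); last exact: finite_II.
move=> x [N' hx]; rewrite /= ltnNge; apply/negP => /pow2_block[j jj xj].
apply: hn; exists (j - j0)%N => /=; first lia.
rewrite subnKC; last lia.
exists (maxn N' x.+1) => // N /= hN; split => //.
have [T hT tw] := hx N (leq_trans (leq_maxl _ _) hN).
exists T => //; apply: has_typ_words xj _ tw.
exact: (leq_trans (leq_maxr _ _) hN).
Qed.

End FinitelyMany.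

(** This is [ln s <= s - 1] at [s = v / u]; replacing the denominator [u] by [v] costs the factor
    2. *)
Lemma subr_div_le_ln (R : realType) (u v : R) : 0 < v -> v <= u -> u <= 2 * v ->
  (u - v) / v <= 2 * (ln u - ln v).
Proof.
move=> v0 vu u2v; have u0 : 0 < u by apply: lt_le_trans vu.
have h : ln (v / u) <= v / u - 1.
  have := @le_ln1Dx R (v / u - 1); rewrite [1 + _]addrC subrK; apply.
  by rewrite ltrBrDr addrC subrr divr_gt0.
rewrite ln_div ?posrE // in h.
have h2 : 1 - v / u <= ln u - ln v by lra.
apply: (@le_trans _ _ (2 * (1 - v / u))); last by rewrite ler_pM2l.
have -> : 2 * (1 - v / u) = (u - v) * (2 / u) by field; rewrite lt0r_neq0.
rewrite ler_wpM2l ?subr_ge0 // ler_pdivlMr // mulrC ler_pdivrMr //.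
Qed.

(** * Second moment of the weighted pattern count *)

Section SecondMoment.
Variables (R : realType) (p : nat -> R).
Hypothesis p_gt0 : forall x, 0 < p x.
Hypothesis p_le1 : forall x, p x <= 1.
Variables (m n N0 a M N : nat) (B : nat -> R) (C : R).
Hypothesis rho_le1 : forall x, (N0 < x)%N -> rho p x <= 1.
Hypothesis N0a : (N0 <= a)%N.
Hypothesis a2 : (2 <= a)%N.
Hypothesis MN : (M.+2 <= N)%N.
(** [B i] bounds the telescoped logarithms, and [BC] makes it at most of order [ln i]; the
    assumption D(n) <= delta n ln n supplies both. *)
Hypothesis lnB : forall i k, (a <= i)%N -> (i.+2 < k)%N -> ln (Dmn p i.+2 k) <= B i.
Hypothesis BC : forall i, (a <= i)%N -> (ln (i%:R : R))^-1 * (6 + 12 * B i) <= C.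

Let om (i : nat) : R := (ln i%:R)^-1.
Let e (j : nat) : R := pat_weight p m n j / Dmn p j.+2 N.
Let pat (j : nat) := pattern m n j.

Let om_ge0 i : (a <= i)%N -> 0 <= om i.
Proof. by move=> ai; rewrite invr_ge0 ln_nat_ge0 //; lia. Qed.

Let om_le i j : (a <= i)%N -> (i <= j)%N -> om j <= om i.
Proof.
move=> ai ij; rewrite lef_pV2 ?posrE ?ln_gt0 ?ltr1n //; try lia.
by rewrite ler_ln ?posrE ?ltr0n ?ler_nat //; lia.
Qed.

Let wt_le1 x w : wt p x w <= 1.
Proof.
rewrite /wt; elim: w => [|b w IH]; first by rewrite big_nil.
rewrite big_cons mulr_ile1 //; first by case: b; rewrite ?subr_ge0 // ltW.
- exact: wt_ge0.
- by case: b => //; rewrite lerBlDr lerDl ltW.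
Qed.

Lemma pat_weight_le1 j : pat_weight p m n j <= 1.
Proof. by rewrite /pat_weight !mulr_ile1 ?mulr_ge0 ?wt_ge0. Qed.

Let e_ge0 j : 0 <= e j.
Proof. by rewrite divr_ge0 ?pat_weight_ge0 // Dmn_ge0. Qed.

(** For [i <= j], [e i * g i j] bounds the covariance of the indicators at [i] and [j]: overlapping
    patterns get the trivial bound [e i], the others a difference that telescopes in [j]. *)
Let g (i j : nat) : R :=
  if (j < i.+3)%N then 1 else 6 * (ln (Dmn p i.+2 j.+1) - ln (Dmn p i.+2 j)).

Let g_ge0 i j : 0 <= g i j.
Proof.
rewrite /g; case: ifPn => // ij; rewrite mulr_ge0 // subr_ge0.
rewrite ler_ln ?posrE ?Dmn_gt0 //; [exact: Dmn_le|lia..].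
Qed.

Let r (i j : nat) : R := if (i <= j)%N then e i * g i j else 0.

Let r_ge0 i j : 0 <= r i j.
Proof. by rewrite /r; case: ifP => _ //; rewrite mulr_ge0. Qed.

(** The three overlapping indices give 3; the others telescope from
    [ln (Dmn p i.+2 i.+3) = ln 1 = 0]. Prolonging the sum to [i.+3 + M] avoids a cut within the
    first three terms. *)
Let sum_g i : (a <= i)%N -> \sum_(i <= j < M) g i j <= 3 + 6 * B i.
Proof.
move=> ai.
have le1 : \sum_(i <= j < M) g i j <= \sum_(i <= j < i.+3 + M) g i j.
  have [iM|/ltnW iM] := leqP i M; last by rewrite (big_geq iM) sumr_ge0.
  have MM : (M <= i.+3 + M)%N by rewrite leq_addl.
  by rewrite [leRHS](big_cat_nat iM MM) lerDl sumr_ge0.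
apply: (le_trans le1).
have -> : \sum_(i <= j < i.+3 + M) g i j = 3 + 6 * ln (Dmn p i.+2 (i.+3 + M)).
  elim: M => [|k IH].
    rewrite addn0 Dmn_diagS ln1 mulr0 addr0 big_nat_recr 1?big_nat_recr ?big_nat1 //=; try lia.
    rewrite /g !ifT //; try lia; lra.
  rewrite addnS big_nat_recr /=; last lia.
  by rewrite IH /g ifF; [lra|lia].
by rewrite lerD2l ler_pM2l // lnB //; lia.
Qed.

Let sum_r i : (a <= i < M)%N -> \sum_(a <= j < M) om j * r i j <= om i * e i * (3 + 6 * B i).
Proof.
move=> /andP[ai iM].
rewrite (big_cat_nat ai (ltnW iM)) /=.
rewrite [X in X + _](_ : _ = 0) ?add0r; last first.
  rewrite big_nat_cond; apply: big1 => j /andP[/andP[_ ji] _].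
  by rewrite /r leqNgt ji mulr0.
apply: (@le_trans _ _ (\sum_(i <= j < M) om i * e i * g i j)).
  apply: ler_sum_nat => j /andP[ij _]; rewrite /r ij -[leRHS]mulrA.
  apply: ler_wpM2r; first by rewrite mulr_ge0.
  exact: om_le.
by rewrite -mulr_sumr ler_wpM2l ?sum_g // mulr_ge0 // om_ge0.
Qed.

Let Eb_pat j : (j < M)%N -> Eb p N 0 (fun t => (pat j t)%:R%:E) = (e j)%:E.
Proof. by move=> jM; rewrite Eb_pattern1 //; lia. Qed.

(* For [i + 3 <= j] the covariance is
   [w_i w_j / D(j+2,N) * (1 / D(i+2,j) - 1 / D(i+2,N))], and the difference is
   [rho_(i+3)...rho_j D(j,N) / (D(i+2,j) D(i+2,N))]. *)
Let cov_le i j : (a <= i)%N -> (i.+3 <= j)%N -> (j < M)%N ->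
  pat_weight p m n j * (pat_weight p m n i / Dmn p i.+2 j) / Dmn p j.+2 N <=
  e i * e j + e i * (6 * (ln (Dmn p i.+2 j.+1) - ln (Dmn p i.+2 j))).
Proof.
move=> ai ij jM.
have d1 : 0 < Dmn p i.+2 j by apply: Dmn_gt0 => //; lia.
have d2 : 0 < Dmn p i.+2 N by apply: Dmn_gt0 => //; lia.
have d3 : 1 <= Dmn p j.+2 N by apply: Dmn_ge1 => //; lia.
have d30 : 0 < Dmn p j.+2 N by apply: lt_le_trans d3.
have rl x : (i.+2 < x)%N -> rho p x <= 1 by move=> ix; apply: rho_le1; lia.
have rl' x : (j < x)%N -> rho p x <= 1 by move=> ix; apply: rho_le1; lia.
have s1 : Dmn p i.+2 N = Dmn p i.+2 j + rho_prod p i.+2 j * Dmn p j N.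
  by apply: Dmn_split; lia.
have s2 : Dmn p i.+2 j.+1 = Dmn p i.+2 j + rho_prod p i.+2 j by apply: DmnS; lia.
have s3 : Dmn p j N = Dmn p j j.+2 + rho_prod p j j.+2 * Dmn p j.+2 N.
  by apply: Dmn_split; lia.
have rp0 := rho_prod_ge0 p_gt0 p_le1 i.+2 j.
have rp1 : rho_prod p i.+2 j <= 1 by apply: rho_prod_le1.
(* Two terms of at most one, and at most one times D(j + 2, N), which itself is at least one. This
   is the 3 in [6 = 2 * 3]; the 2 comes from [subr_div_le_ln]. *)
have d4 : Dmn p j N <= 3 * Dmn p j.+2 N.
  have q1 : Dmn p j j.+2 <= 2.
    by have := Dmn_le_sub p_gt0 p_le1 rl' (leqW (leqnSn j)); rewrite -{2}addn2 addKn.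
  have q2 : rho_prod p j j.+2 <= 1 by apply: rho_prod_le1.
  have q3 := ler_wpM2r (ltW d30) q2.
  rewrite s3; lra.
have d5 : 1 <= Dmn p i.+2 j by apply: Dmn_ge1 => //; lia.
have l1 : rho_prod p i.+2 j / Dmn p i.+2 j <=
    2 * (ln (Dmn p i.+2 j.+1) - ln (Dmn p i.+2 j)).
  have := @subr_div_le_ln R (Dmn p i.+2 j.+1) (Dmn p i.+2 j) d1.
  rewrite [X in (X - _) / _]s2 (addrC (Dmn p i.+2 j)) addrK; apply.
    by apply: Dmn_le.
  by rewrite s2; lra.
set W := pat_weight p m n j; set V := pat_weight p m n i.
have W1 : W <= 1 by apply: pat_weight_le1.
have W0 : 0 <= W by apply: pat_weight_ge0.
have V0 : 0 <= V by apply: pat_weight_ge0.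
have eqn : W * (V / Dmn p i.+2 j) / Dmn p j.+2 N = e i * e j +
    e i * (W * (rho_prod p i.+2 j / Dmn p i.+2 j) * (Dmn p j N / Dmn p j.+2 N)).
  rewrite /e -/W -/V.
  apply: (@mulIf _ (Dmn p i.+2 N)); first by rewrite lt0r_neq0.
  rewrite [in LHS]s1; field.
  by rewrite !lt0r_neq0.
rewrite eqn lerD2l ler_wpM2l // (_ : 6 = 2 * 3); last by lra.
have -> : 2 * 3 * (ln (Dmn p i.+2 j.+1) - ln (Dmn p i.+2 j)) =
  2 * (ln (Dmn p i.+2 j.+1) - ln (Dmn p i.+2 j)) * 3 by ring.
apply: ler_pM.
- by rewrite mulr_ge0 // divr_ge0 // ltW.
- by rewrite divr_ge0 ?Dmn_ge0.
- by apply: le_trans l1; apply: ler_piMl => //; apply: divr_ge0 => //; exact: ltW.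
- by rewrite ler_pdivrMr.
Qed.

Let pair_le i j : (a <= i)%N -> (i <= j)%N -> (j < M)%N ->
  (Eb p N 0 (fun t => (pat i t && pat j t)%:R%:E) <= (e i * e j + r i j)%:E)%E.
Proof.
move=> ai ij jM; rewrite /r ij /g; case: ifPn => h.
  apply: (@le_trans _ _ (e i)%:E); last by rewrite lee_fin mulr1 lerDr mulr_ge0.
  rewrite -Eb_pat; last exact: leq_ltn_trans jM.
  by apply: le_Eb => // t _; rewrite lee_fin ler_nat; case: (pat i t) => //; exact: leq_b1.
rewrite Eb_pattern2; [|by []|by []|lia|lia].
by rewrite lee_fin cov_le //; lia.
Qed.

Let pair_le_sym i j : (a <= i < M)%N -> (a <= j < M)%N ->
  (Eb p N 0 (fun t => (pat i t && pat j t)%:R%:E) <= (e i * e j + (r i j + r j i))%:E)%E.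
Proof.
move=> /andP[ai iM] /andP[aj jM]; have [ij|/ltnW ji] := leqP i j.
  by apply: (le_trans (pair_le ai ij jM)); rewrite lee_fin addrA lerDl.
rewrite (eq_Eb (fun t => (pat j t && pat i t)%:R%:E)); last by move=> t _; rewrite andbC.
apply: (le_trans (pair_le aj ji iM)).
by rewrite lee_fin [e j * _]mulrC [r i j + _]addrC addrA lerDl.
Qed.

Definition pat_sum (t : seq (seq bool)) : R := \sum_(a <= j < M) om j * (pat j t)%:R.

Definition pat_mean : R := \sum_(a <= j < M) om j * e j.

Lemma pat_sum_ge0 t : 0 <= pat_sum t.
Proof.
rewrite /pat_sum big_nat_cond; apply: sumr_ge0 => j /andP[/andP[aj _] _].
by rewrite mulr_ge0 ?ler0n ?om_ge0.
Qed.

Let sum_nat_cond (F : nat -> R) :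
  \sum_(a <= j < M) F j = \sum_(j <- index_iota a M | (a <= j < M)%N) F j.
Proof. by rewrite big_nat_cond; apply: eq_bigl => j; rewrite andbT. Qed.

Lemma Eb_pat_sum : Eb p N 0 (fun t => (pat_sum t)%:E) = pat_mean%:E.
Proof.
rewrite /pat_mean sum_nat_cond -sumEFin.
(* [maxn a j] is [j] on the range of summation, and makes the weight nonnegative at every index, as
   [Eb_sum] requires. *)
have F0 j t : (0 <= (om (maxn a j))%:E * (pat j t)%:R%:E)%E.
  by rewrite mule_ge0 ?lee_fin ?ler0n // om_ge0 // leq_maxl.
rewrite (eq_Eb (fun t => \sum_(j <- index_iota a M | (a <= j < M)%N)
  ((om (maxn a j))%:E * (pat j t)%:R%:E))%E); last first.
  move=> t _; rewrite /pat_sum sum_nat_cond -sumEFin; apply: eq_bigr => j /andP[aj _].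
  by rewrite (maxn_idPr aj) EFinM.
rewrite Eb_sum //; apply: eq_bigr => j /andP[aj jM].
by rewrite EbZ ?om_ge0 ?leq_maxl // Eb_pat // (maxn_idPr aj) EFinM.
Qed.

(** Each covariance is charged to its smaller index. The share of [i] is then at most [om i * e i]
    times [om i * (6 + 12 * B i)], and the latter factor is at most [C]. *)
Lemma Eb_pat_sum2 :
  (Eb p N 0 (fun t => (pat_sum t ^+ 2)%:E) <= (pat_mean ^+ 2 + C * pat_mean)%:E)%E.
Proof.
have o0 j : 0 <= om (maxn a j) by rewrite om_ge0 // leq_maxl.
have F0 i j t : (0 <= (om (maxn a i) * om (maxn a j))%:E * (pat i t && pat j t)%:R%:E)%E.
  by rewrite mule_ge0 ?lee_fin ?ler0n // mulr_ge0.
rewrite (eq_Eb (fun t => \sum_(i <- index_iota a M | (a <= i < M)%N)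
  \sum_(j <- index_iota a M | (a <= j < M)%N)
  ((om (maxn a i) * om (maxn a j))%:E * (pat i t && pat j t)%:R%:E))%E); last first.
  move=> t _; rewrite /pat_sum sum_nat_cond expr2 mulr_suml -sumEFin.
  apply: eq_bigr => i /andP[ai _]; rewrite mulr_sumr -sumEFin.
  apply: eq_bigr => j /andP[aj _]; rewrite (maxn_idPr aj) (maxn_idPr ai) -EFinM.
  by rewrite -mulnb natrM; congr EFin; ring.
rewrite Eb_sum //; last by move=> i t; apply: sume_ge0 => j _; exact: F0.
apply: (@le_trans _ _ (\sum_(i <- index_iota a M | (a <= i < M)%N)
  \sum_(j <- index_iota a M | (a <= j < M)%N)
  (om i * om j * (e i * e j + (r i j + r j i)))%:E)%E).
  apply: lee_sum => i hi; rewrite Eb_sum //; apply: lee_sum => j hj.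
  rewrite EbZ //; last by rewrite mulr_ge0.
  case/andP: (hi) (hj) => ai _ /andP[aj _]; rewrite (maxn_idPr ai) (maxn_idPr aj) [leRHS]EFinM.
  by apply: lee_wpmul2l; [rewrite lee_fin mulr_ge0 // om_ge0|exact: pair_le_sym].
under eq_bigr do rewrite sumEFin.
rewrite sumEFin lee_fin.
have -> : \sum_(i <- index_iota a M | (a <= i < M)%N)
  \sum_(j <- index_iota a M | (a <= j < M)%N) (om i * om j * (e i * e j + (r i j + r j i))) =
  pat_mean ^+ 2 + 2 * \sum_(i <- index_iota a M | (a <= i < M)%N)
    (om i * \sum_(j <- index_iota a M | (a <= j < M)%N) om j * r i j).
  rewrite /pat_mean sum_nat_cond expr2 mulr_suml.
  have -> : 2 * \sum_(i <- index_iota a M | (a <= i < M)%N)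
      (om i * \sum_(j <- index_iota a M | (a <= j < M)%N) om j * r i j) =
    \sum_(i <- index_iota a M | (a <= i < M)%N)
      \sum_(j <- index_iota a M | (a <= j < M)%N) om i * om j * r i j +
    \sum_(i <- index_iota a M | (a <= i < M)%N)
      \sum_(j <- index_iota a M | (a <= j < M)%N) om i * om j * r j i.
    rewrite [X in _ + X]exchange_big /= mulr2n mulrDl mul1r; congr (_ + _);
      apply: eq_bigr => i _; rewrite mulr_sumr; apply: eq_bigr => j _; ring.
  rewrite -!big_split /=; apply: eq_bigr => i _.
  rewrite mulr_sumr -!big_split /=; apply: eq_bigr => j _; ring.
rewrite lerD2l mulr_sumr /pat_mean [in leRHS]sum_nat_cond mulr_sumr.
apply: ler_sum => i hi; rewrite -sum_nat_cond.
have ai : (a <= i)%N by case/andP: hi.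
apply: (@le_trans _ _ (2 * (om i * (om i * e i * (3 + 6 * B i))))).
  by rewrite ler_pM2l // ler_wpM2l ?sum_r // om_ge0.
have -> : 2 * (om i * (om i * e i * (3 + 6 * B i))) =
  (om i * (6 + 12 * B i)) * (om i * e i) by ring.
by apply: ler_wpM2r; [rewrite mulr_ge0 ?om_ge0|exact: BC].
Qed.

(** Chebyshev: [pat_sum t <= t0] forces a deviation of at least half the mean, and the variance is
    at most [C] times the mean. *)
Lemma Eb_pat_sum_small t0 : 0 < pat_mean -> 2 * t0 <= pat_mean ->
  (Eb p N 0 (fun t => (pat_sum t <= t0)%R%:R%:E) <= (4 * C / pat_mean)%:E)%E.
Proof.
set mu := pat_mean => mu0 ht.
have sq0 (t : seq (seq bool)) : (0 <= ((pat_sum t - mu) ^+ 2)%:E)%E.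
  by rewrite lee_fin sqr_ge0.
have var : (Eb p N 0 (fun t => ((pat_sum t - mu) ^+ 2)%:E) <= (C * mu)%:E)%E.
  (* [EbD] is for nonnegative functions, so the cross term of the square is moved to the left
     side. *)
  have E : (Eb p N 0 (fun t => ((pat_sum t - mu) ^+ 2)%:E) + (2 * mu * mu)%:E =
      Eb p N 0 (fun t => (pat_sum t ^+ 2)%:E) + (mu ^+ 2)%:E)%E.
    have -> : ((2 * mu * mu)%:E = Eb p N 0 (fun t => (2 * mu)%:E * (pat_sum t)%:E))%E.
      rewrite EbZ ?Eb_pat_sum -?EFinM //; first by rewrite mulr_ge0 // ltW.
      by move=> t; rewrite lee_fin pat_sum_ge0.
    have -> : ((mu ^+ 2)%:E = Eb p N 0 (fun t => (mu ^+ 2)%:E * 1))%E.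
      by rewrite EbZ ?Eb1 ?mule1 // sqr_ge0.
    rewrite -!EbD //.
    - by apply: eq_Eb => t _; rewrite mule1 -EFinM -!EFinD; congr EFin; ring.
    - by move=> t; rewrite lee_fin sqr_ge0.
    - by move=> t; rewrite mule1 lee_fin sqr_ge0.
    - by move=> t; rewrite -EFinM lee_fin !mulr_ge0 ?pat_sum_ge0 // ltW.
  have H : (Eb p N 0 (fun t => ((pat_sum t - mu) ^+ 2)%:E) + (2 * mu * mu)%:E <=
      (mu ^+ 2 + C * mu + mu ^+ 2)%:E)%E.
    by rewrite E EFinD; apply: leeD => //; exact: Eb_pat_sum2.
  move: H; rewrite -leeBrDr // -EFinB.
  by rewrite (_ : _ - _ = C * mu)%R; last ring.
apply: (@le_trans _ _ ((4 / mu ^+ 2)%:E * Eb p N 0 (fun t => ((pat_sum t - mu) ^+ 2)%:E))%E).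
  rewrite -EbZ //; last by rewrite divr_ge0 // sqr_ge0.
  apply: le_Eb => // t _; rewrite -EFinM lee_fin.
  case: (leP (pat_sum t) t0) => h /=; last by rewrite mulr_ge0 ?divr_ge0 ?sqr_ge0.
  rewrite mulrAC ler_pdivlMr ?exprn_gt0 // mul1r.
  have h2 : mu <= 2 * (mu - pat_sum t) by lra.
  have h3 : 0 <= mu - pat_sum t by lra.
  rewrite !expr2; nra.
apply: (le_trans (lee_wpmul2l _ var)); first by rewrite lee_fin divr_ge0 // sqr_ge0.
rewrite -EFinM lee_fin le_eqVlt; apply/orP; left; apply/eqP.
by field; rewrite lt0r_neq0.
Qed.

End SecondMoment.

(** * Frozen words and weak cutpoints *)

Section PathPatterns.
Local Open Scope nat_scope.
Implicit Types Y : nat -> nat.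

Lemma first_hit_mono Y N N' T T' : nnpath Y -> first_hit Y N T -> first_hit Y N' T' ->
  N <= N' -> T <= T'.
Proof.
move=> nY [_ hT] [YT' _] NN'; rewrite -YT' in NN'.
have [i iT' Yi] := nnpath_cross nY NN'.
by rewrite leqNgt; apply/negP => h; apply: (hT i) => //; apply: leq_ltn_trans h.
Qed.

(** Words only grow with time, so equality at two times fixes the word in between. *)
Lemma word_squeeze Y x T1 T T2 v : T1 <= T -> T <= T2 ->
  word Y x T1 = v -> word Y x T2 = v -> word Y x T = v.
Proof.
move=> h1 h2 e1 e2; have [s es] := word_prefix Y x h1; have [s' es'] := word_prefix Y x h2.
move: es'; rewrite e2 es e1 -catA => /(congr1 size)/eqP.
rewrite !size_cat -{1}[size v]addn0 eqn_add2l eq_sym addn_eq0 => /andP[/nilP -> _].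
by rewrite cats0.
Qed.

Lemma low_words Y T k n : k <= n -> low k (words Y T n) = words Y T k.
Proof.
elim: n => [|n IH]; first by rewrite leqn0 => /eqP ->.
rewrite leq_eqVlt => /orP[/eqP ->|kn]; last by rewrite /= low_cons ?size_words ?IH.
by rewrite -{1}(size_words Y T n.+1) low_id.
Qed.

Lemma pattern_words m n j Y T N : j.+3 <= N ->
  pattern m n j (words Y T N) =
  [&& word Y j.+2 T == pat2 n, word Y j.+1 T == pat1 m n & word Y j T == pat0 m].
Proof.
by move=> jN; rewrite /pattern low_words //= take0 !eqseq_cons eqxx andbT.
Qed.

(** Without a step down from [x + 1] the edge below is crossed only once, so the first hit of
    [x + 1] separates the path. *)
Lemma upcross_Cw Y x : nnpath Y -> (forall N, exists t, Y t = N) ->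
  (forall t, downs (word Y x.+1 t) = 0) -> Cw Y x.+1.
Proof.
move=> nY hitY d0; have [t0 /first_hit_exists[k hk]] := hitY x.+1.
exists k; split; first by case: hk.
split=> [i ik|i ki]; first exact: ltnW (first_hit_lt nY hk ik).
have := ups_downs x i nY; have := ups_downs x k nY; rewrite !d0 (proj1 hk) ltnSn !add0n.
have [s ->] := word_prefix Y x (ltnW ki); rewrite count_cat => ->.
by case: (ltnP x (Y i)) => //; lia.
Qed.

(** Before the cut time [k] the path is at most [x] and leaves [x] downwards; after [k] it is at
    least [x] and leaves it upwards. *)
Lemma Cw_down_up Y x T : nnpath Y -> Cw Y x -> down_up (word Y x T).
Proof.
move=> [Y0 YS] [k [Yk [hl hr]]].
have du_falses w b : all negb w -> down_up (rcons w b).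
  by elim: w => [|[] w IH] //= _; case: b.
have du_true w : down_up w -> down_up (rcons w true).
  by elim: w => [|[] w IH] //=; rewrite all_rcons.
have lo t : t <= k -> all negb (word Y x t).
  elim: t => // t IH tk; rewrite wordS; case: eqP => e; last by apply: IH; exact: ltnW.
  rewrite all_rcons IH ?(ltnW tk) // andbT.
  have : Y t.+1 <= x.
    by move: tk; rewrite leq_eqVlt => /orP[/eqP ->|]; [rewrite Yk|exact: hl].
  by lia.
case: (leqP T k) => [/lo|].
  by elim: (word Y x T) => [|[] w IH].
elim: T => // T IH; rewrite ltnS wordS leq_eqVlt => /orP[/eqP <-|kT].
  by rewrite Yk eqxx; apply/du_falses/lo.
case: eqP => e; last exact: IH.
suff -> : (Y T.+1 == x.+1) = true by apply/du_true/IH.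
by have := hr T.+1 (leqW kT); move: (YS T); lia.
Qed.

End PathPatterns.

(** * Infinitude by Chebyshev's inequality *)

Section InfinitelyMany.
Context {R : realType} {d : measure_display} {Omega : measurableType d}.
Variables (P : probability Omega R) (p : nat -> R) (X : Omega -> nat -> nat).
Hypothesis p0 : p 0%N = 1.
Hypothesis p_gt0 : forall x, 0 < p x.
Hypothesis p_le1 : forall x, p x <= 1.
Hypothesis hX : is_chain P p X.
Variables (m n N0 a : nat) (B : nat -> R) (C c0 : R).
Hypothesis rho_le1 : forall x, (N0 < x)%N -> rho p x <= 1.
Hypothesis N0a : (N0 <= a)%N.
Hypothesis a2 : (2 <= a)%N.
Hypothesis lnB : forall i k, (a <= i)%N -> (i.+2 < k)%N -> ln (Dmn p i.+2 k) <= B i.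
Hypothesis BC : forall i, (a <= i)%N -> (ln (i%:R : R))^-1 * (6 + 12 * B i) <= C.
Hypothesis C_ge0 : 0 <= C.
Hypothesis c0_gt0 : 0 < c0.
Hypothesis c0_le : forall j, (a <= j)%N -> c0 <= pat_weight p m n j.
Hypothesis Doo : Dseries p = +oo%E.

Definition pat_sites (w : Omega) : set nat :=
  [set j | exists N', forall N, (N' <= N)%N ->
    exists2 T, first_hit (X w) N T & pattern m n j (words (X w) T N)].

(** A pattern seen at arbitrarily late hits is seen at all hits in between, since its three words
    are squeezed. So a site either shows it at all late hits or at none. *)
Lemma not_pat_sites w j : good X w -> ~ pat_sites w j ->
  exists N', forall N T, (N' <= N)%N -> first_hit (X w) N T ->
    ~~ pattern m n j (words (X w) T N).
Proof.
move=> gw nj; apply: contrapT => /forallNP H; apply: nj.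
have io N' : exists N T, [/\ (N' <= N)%N, first_hit (X w) N T & pattern m n j (words (X w) T N)].
  have /existsNP[N /existsNP[T h]] := H N'.
  exists N, T; apply: contrapT => h'; apply: h => NN' hT.
  by apply/negP => pt; apply: h'.
have [N1 [T1 [N1j hT1 pt1]]] := io j.+3.
exists N1 => N N1N; have [T hT] := good_hit N gw; exists T => //.
have [N2 [T2 [NN2 hT2 pt2]]] := io N.
have nw := proj1 gw.
have T1T := first_hit_mono nw hT1 hT N1N.
have TT2 := first_hit_mono nw hT hT2 NN2.
have jN := leq_trans N1j N1N; have jN2 := leq_trans jN NN2.
move: pt1 pt2; rewrite !pattern_words //.
move=> /and3P[/eqP u2 /eqP u1 /eqP u0] /and3P[/eqP v2 /eqP v1 /eqP v0].
rewrite (word_squeeze T1T TT2 u2 v2) (word_squeeze T1T TT2 u1 v1).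
by rewrite (word_squeeze T1T TT2 u0 v0) !eqxx.
Qed.

Lemma not_pat_sites_below w M : good X w ->
  exists N', forall j, (j < M)%N -> ~ pat_sites w j ->
    forall N T, (N' <= N)%N -> first_hit (X w) N T -> ~~ pattern m n j (words (X w) T N).
Proof.
move=> gw; elim: M => [|M [N' IH]]; first by exists 0%N.
have [jM|njM] := pselect (pat_sites w M).
  exists N' => j; rewrite ltnS leq_eqVlt => /orP[/eqP -> //|jM' nj].
  exact: IH.
have [N2 h2] := not_pat_sites gw njM.
exists (maxn N' N2) => j; rewrite ltnS leq_eqVlt => /orP[/eqP -> _|jM' nj] N T.
  by rewrite geq_max => /andP[_ ?]; exact: h2.
by rewrite geq_max => /andP[? _]; exact: IH.
Qed.

Lemma Dinv_le k N : (k < N)%N -> Dinv p k <= (Dmn p k N)^-1.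
Proof.
move=> kN; have D0 := Dmn_gt0 p_gt0 p_le1 kN.
rewrite /Dinv; case: ifPn => h; first by rewrite invr_ge0 ltW.
have := Dmn_le_Dinf p_gt0 p_le1 k N; rewrite (Dinf_fin p_gt0 p_le1 h) lee_fin => le.
by rewrite lef_pV2 // posrE // (lt_le_trans D0).
Qed.

Lemma Dterm_sum_unbounded (b : R) : exists2 M, (a <= M)%N &
  b <= c0 * \sum_(a <= j < M) (Dinv p j.+2 / ln j.+2%:R).
Proof.
pose t k : R := Dinv p k / ln k%:R.
have t0 k : (2 <= k)%N -> 0 <= t k.
  by move=> k2; rewrite divr_ge0 ?Dinv_ge0 // ln_nat_ge0 // ltnW.
apply: contrapT => /forall2NP H.
have bound k : \sum_(2 <= i < k) t i <= b / c0 + \sum_(2 <= i < a.+2) t i.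
  have a22 : (2 <= a.+2)%N by lia.
  apply: (@le_trans _ _ (\sum_(2 <= i < k + a.+2) t i)).
    have [k2|/ltnW k2] := leqP 2 k; last first.
      rewrite (big_geq k2) big_nat_cond; apply: sumr_ge0 => i /andP[/andP[? _] _]; exact: t0.
    rewrite [leRHS](@big_cat_nat _ _ _ k) //= ?leq_addr // lerDl.
    rewrite big_nat_cond; apply: sumr_ge0 => i /andP[/andP[? _] _]; apply: t0; lia.
  rewrite (@big_cat_nat _ _ _ a.+2) //= ?leq_addl // addrC lerD2r.
  have [|/negP] := H (k + a)%N; first by rewrite leq_addl.
  rewrite -ltNge => /ltW; rewrite mulrC -ler_pdivlMr // => h.
  apply: le_trans h; rewrite [leRHS](_ : _ = \sum_(a <= j < k + a) t (j + 2)%N).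
    have -> : \sum_(a <= j < k + a) t (j + 2)%N = \sum_(a + 2 <= j < k + a + 2) t j.
      by rewrite big_addn addnK.
    by rewrite -addnA addn2.
  by apply: eq_bigr => j _; rewrite addn2.
suff : (Dseries p <= (b / c0 + \sum_(2 <= i < a.+2) t i)%:E)%E by rewrite Doo.
apply: lime_le.
  by apply: is_cvg_nneseries => k k2 _; exact: Dterm_ge0.
apply: nearW => k; under eq_bigr do rewrite Dterm_Dinv.
by rewrite sumEFin lee_fin.
Qed.

(** The event that the total weighted count is at most [t0], phrased through finite cutoffs and late
    hits. *)
Definition sparse_event (t0 : nat) : set Omega :=
  \bigcap_M hit_liminf X (fun t => pat_sum R m n a M t <= t0%:R).

Lemma measurable_sparse_event t0 : measurable (sparse_event t0).
Proof. by apply: bigcap_measurableType => M _; exact: (measurable_hit_liminf hX). Qed.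

Lemma P_sparse_event_le t0 (b : R) : 0 < b -> 2 * t0%:R <= b ->
  (P (sparse_event t0) <= (4 * C / b)%:E)%E.
Proof.
move=> b0 bt; have [M aM hM] := Dterm_sum_unbounded b.
apply: (@le_trans _ _ (P (hit_liminf X (fun t => pat_sum R m n a M t <= t0%:R)))).
  apply: probability_le; first exact: measurable_sparse_event.
    exact: (measurable_hit_liminf hX).
  exact: bigcap_inf.
apply: (P_hit_liminf hX (a := fun=> 4 * C / b)); first exact: cvg_cst.
near=> N.
have MN : (M.+2 <= N)%N by near: N; exact: nbhs_infty_ge.
(* [M] was chosen from the limits D(j + 2); since D(j + 2, N) increases to its limit, the mean at a
   finite [N] is at least as large. *)
have bmu : b <= pat_mean p m n a M N.
  apply: (le_trans hM); rewrite mulr_sumr; apply: ler_sum_nat => j /andP[aj jM].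
  have jN : (j.+2 < N)%N by lia.
  rewrite mulrA mulrC; apply: ler_pM.
  - by rewrite invr_ge0 ln_nat_ge0.
  - by rewrite mulr_ge0 ?Dinv_ge0 // ltW.
  - rewrite lef_pV2 ?posrE ?ln_gt0 ?ltr1n //; last lia.
    by rewrite ler_ln ?posrE ?ltr0n ?ler_nat //; lia.
  - by apply: ler_pM; rewrite ?Dinv_ge0 ?c0_le ?Dinv_le // ltW.
have mu0 : 0 < pat_mean p m n a M N by apply: lt_le_trans bmu.
apply: (le_trans (P_hit_event p_gt0 p_le1 hX N _)).
apply: (le_trans (Eb_pat_sum_small p_gt0 p_le1 rho_le1 N0a a2 MN lnB BC mu0 _)).
  exact: le_trans bmu.
by rewrite lee_fin ler_wpM2l ?mulr_ge0 // lef_pV2.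
Unshelve. all: by end_near. Qed.

Lemma P_sparse_event t0 : P (sparse_event t0) = 0%E.
Proof.
have Pf : P (sparse_event t0) \is a fin_num.
  by apply: fin_num_measure; exact: measurable_sparse_event.
pose x := fine (P (sparse_event t0)).
have xE : P (sparse_event t0) = x%:E by rewrite fineK.
have x0 : 0 <= x by rewrite fine_ge0.
have H b : 0 < b -> 2 * t0%:R <= b -> x <= 4 * C / b.
  by move=> b0 bt; rewrite -lee_fin -xE; exact: P_sparse_event_le.
rewrite xE; suff -> : x = 0 by [].
apply/eqP; rewrite eq_le x0 andbT leNgt; apply/negP => xp.
(* This [b] is at least [2 * t0%:R] and makes [4 * C / b] smaller than [x]. *)
pose b := 2 * t0%:R + 1 + 8 * C / x.
have tt : 0 <= t0%:R :> R by rewrite ler0n.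
have Cx : 0 <= 8 * C / x by rewrite divr_ge0 ?mulr_ge0.
have b0 : 0 < b by rewrite /b; lra.
have bt : 2 * t0%:R <= b by rewrite /b; lra.
have := H b b0 bt; rewrite ler_pdivlMr //; apply/negP; rewrite -ltNge.
have -> : x * b = x * (2 * t0%:R + 1) + 8 * C by rewrite /b; field; rewrite lt0r_neq0.
have xt : 0 < x * (2 * t0%:R + 1) by rewrite mulr_gt0 //; lra.
have := C_ge0; move: xt; set y := x * _; lra.
Qed.

Lemma inv_ln_nat_ge0 j : 0 <= (ln (j%:R : R))^-1.
Proof. by rewrite invr_ge0; case: j => [|j]; [rewrite ln0|exact: ln_nat_ge0]. Qed.

Lemma infinitely_many_pattern : {ae P, forall w, good X w /\ infinite_set (pat_sites w)}.
Proof.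
have nS : P.-negligible (\bigcup_t0 sparse_event t0).
  apply: negligible_bigcup => t0; apply/negligibleP; first exact: measurable_sparse_event.
  exact: P_sparse_event.
apply: negligibleS (negligibleU (good_ae p0 p_gt0 p_le1 hX) nS) => w /= h.
have [gw|] := pselect (good X w); last by left.
right; have fin : finite_set (pat_sites w) by apply: contrapT => ninf; apply: h.
have [b hb] : exists b, forall j, pat_sites w j -> (j < b)%N.
  have /finite_seqP[s es] := fin.
  exists (\max_(j <- s) j).+1 => j; rewrite es /= => js.
  by rewrite ltnS (big_rem j) //= leq_maxl.
(* This exceeds the total weight of the sites from [a] up to [b]: a site from [b] on is no pattern
   site, so at late hits it contributes nothing. *)
exists (Num.truncn (\sum_(a <= j < b) (ln (j%:R : R))^-1)).+1 => // M _.
have [N' hN'] := not_pat_sites_below M gw.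
exists N' => // N /= NN'; split => //.
have [T hT] := good_hit N gw; exists T => //.
apply: le_trans (ltW (truncnS_gt _)).
apply: (@le_trans _ _ (\sum_(a <= j < M + b | (j < b)%N) (ln (j%:R : R))^-1)); last first.
  by rewrite -(big_nat_widen a b (M + b) xpredT) // leq_addl.
have [aM|/ltnW aM] := leqP a M; last first.
  by rewrite /pat_sum (big_geq aM) sumr_ge0 // => j _; exact: inv_ln_nat_ge0.
rewrite [leRHS](@big_cat_nat _ _ _ M) ?leq_addr //=.
apply: (@le_trans _ _ (\sum_(a <= j < M | (j < b)%N) (ln (j%:R : R))^-1)); last first.
  by rewrite lerDl sumr_ge0 // => j _; exact: inv_ln_nat_ge0.
rewrite /pat_sum [leRHS]big_mkcond; apply: ler_sum_nat => j /andP[aj jM].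
have [jb|jb] := ltnP j b.
  by rewrite ler_piMr ?inv_ln_nat_ge0 // lern1 leq_b1.
rewrite (negbTE (hN' j jM _ N T NN' hT)) ?mulr0 //.
by move=> /hb; rewrite ltnNge jb.
Qed.

(** Any late time lies between two hitting times at which the word is the prescribed one. *)
Lemma pat_sites_word w j : good X w -> pat_sites w j ->
  exists T0, forall t, (T0 <= t)%N -> word (X w) j.+1 t = pat1 m n.
Proof.
move=> gw [N' h]; pose N1 := maxn N' j.+3.
have [T1 hT1 pt1] := h N1 (leq_maxl _ _).
exists T1 => t T1t; pose N2 := maxn N1 t.
have N12 : (N1 <= N2)%N by rewrite leq_maxl.
have [T2 hT2 pt2] := h N2 (leq_trans (leq_maxl _ _) N12).
have tT2 : (t <= T2)%N.
  apply: leq_trans (first_hit_ge (proj1 gw) hT2); exact: leq_maxr.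
move: pt1 pt2; rewrite !pattern_words ?leq_maxr //; last first.
  by apply: leq_trans N12; exact: leq_maxr.
move=> /and3P[_ /eqP u1 _] /and3P[_ /eqP v1 _].
exact: word_squeeze T1t tT2 u1 v1.
Qed.

Lemma pat_sites_Cset w j : good X w -> pat_sites w j ->
  Cset (X w) [set (m + n.+1)%N] [set n.+1] j.+1.
Proof.
move=> gw /(pat_sites_word gw)[T0 h]; split; eexists; try reflexivity; exists T0 => t /h e.
  by rewrite -size_word e size_cat !size_nseq.
by rewrite -ups_word e; case: (Wset_pat1 m n).
Qed.

End InfinitelyMany.

Lemma infinite_succ_image (S S' : set nat) :
  infinite_set S -> (forall j, S j -> S' j.+1) -> infinite_set S'.
Proof.
move=> infS h finS'; apply: infS.
apply: (@sub_finite_set _ _ (predn @` S')); last exact: finite_image.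
by move=> j /h Sj; exists j.+1.
Qed.

Lemma Cset_sub Y (A A' B B' : set nat) : A `<=` A' -> B `<=` B' ->
  Cset Y A B `<=` Cset Y A' B'.
Proof.
move=> AA' BB' x [[k Ak hk] [l Bl hl]].
by split; [exists k => //; exact: AA'|exists l => //; exact: BB'].
Qed.

(** * Constants for the two halves *)

Section Constants.
Variables (R : realType) (p : nat -> R).
Hypothesis p_gt0 : forall x, 0 < p x.
Hypothesis p_le1 : forall x, p x <= 1.

Lemma wt_ge_pow (c : R) x w : 0 <= c -> c <= p x -> c <= 1 - p x ->
  c ^+ size w <= wt p x w.
Proof.
move=> c0 cp cq; elim: w => [|b w IH]; first by rewrite wt_nil expr0.
by rewrite wt_cons exprS ler_pM ?exprn_ge0 //; case: b.
Qed.

(** The number of up letters is fixed at [u + 1], so either all words have the type or none. In the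
    first case [u + 1 <= a], and the all-up word has weight at least [c ^+ a]. *)
Lemma typ_ups_le (a : nat) (c : R) N1 : 0 <= c <= 1 ->
  (forall x, (N1 <= x)%N -> c <= p x) ->
  forall n u, (N1 <= n)%N ->
  ((c ^+ a)%:E * K p n u.+1 (fun w => (ups w <= a)%N%:R%:E) <=
   ((ups (nseq u.+1 true) <= a)%N%:R * wt p n (nseq u.+1 true))%:E)%E.
Proof.
move=> /andP[c0 c1] cp n u Nn; rewrite count_nseq mul1n wt_nseq.
rewrite (eq_K (fun w => (u.+1 <= a)%N%:R%:E * 1)%E); last first.
  by move=> w [-> _]; rewrite mule1.
rewrite KZ // K1 // mule1 -EFinM lee_fin mulrC.
case: leqP => ua; rewrite ?mul0r // !mul1r.
apply: (@le_trans _ _ (c ^+ u.+1)); first by rewrite ler_wiXn2l.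
by rewrite lerXn2r ?nnegrE ?cp // ltW.
Qed.

Lemma typ_down_up (c : R) N1 :
  (forall x, (N1 <= x)%N -> c <= p x) ->
  forall n u, (N1 <= n)%N ->
  (c%:E * K p n u.+1 (fun w => (down_up w)%:R%:E) <=
   ((down_up (nseq u.+1 true))%:R * wt p n (nseq u.+1 true))%:E)%E.
Proof.
move=> cp n u Nn; rewrite down_up_nseq mul1r -K_down_up //.
apply: lee_wpmul2r; last by rewrite lee_fin cp.
by apply: K_ge0 => // w; rewrite lee_fin ler0n.
Qed.

(** For [n >= 2] both [n + 2] and [ln (n + 2)] are at most [n ^ 2], so D is at most
    [(1 + delta) * n ^ 4]. The crude power only affects the constant in front of [ln n]; [1 + delta]
    keeps the other logarithm nonnegative. *)
Lemma ln_Dmn_le (delta : R) n k : 0 < delta -> (2 <= n)%N -> (n.+2 < k)%N ->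
  (Dinf p n.+2 <= (delta * n.+2%:R * ln n.+2%:R)%:E)%E ->
  ln (Dmn p n.+2 k) <= ln (1 + delta) + 4 * ln n%:R.
Proof.
move=> d0 n2 nk hD.
have D0 := Dmn_gt0 p_gt0 p_le1 nk.
have n0 : 0 < n%:R :> R by rewrite ltr0n; lia.
have h1 : Dmn p n.+2 k <= delta * n.+2%:R * ln n.+2%:R.
  by rewrite -lee_fin; apply: le_trans hD; exact: Dmn_le_Dinf.
have h2 : n.+2%:R <= n%:R ^+ 2 :> R by rewrite -natrX ler_nat; nia.
have h3 : ln n.+2%:R <= n%:R ^+ 2 :> R.
  by apply: le_trans h2; apply: ltW; apply: ln_sublinear; rewrite ltr0n.
have h4 : Dmn p n.+2 k <= (1 + delta) * n%:R ^+ 4.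
  apply: (le_trans h1); rewrite (_ : 4 = 2 + 2)%N // exprD mulrA.
  apply: ler_pM => //; first by rewrite mulr_ge0 // ltW.
    by rewrite ln_nat_ge0.
  by apply: ler_pM => //; [exact: ltW|lra].
have dd : 0 < 1 + delta by lra.
have -> : ln (1 + delta) + 4 * ln n%:R = ln ((1 + delta) * n%:R ^+ 4).
  by rewrite lnM ?posrE ?exprn_gt0 // lnXn // mulr_natl.
by rewrite ler_ln ?posrE // mulr_gt0 // exprn_gt0.
Qed.

End Constants.

(** * Assembly of the finite and the infinite case *)

Theorem theorem1 (R : realType) (d : measure_display) (Omega : measurableType d)
  (P : probability Omega R) (p : nat -> R) (X : Omega -> nat -> nat)
  (hp0 : p 0%N = 1)
  (hp : forall k, (1 <= k)%N -> 0 < p k /\ 0 < 1 - p k)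
  (hX : is_chain P p X)
  (N0 : nat) (hN0 : (0 < N0)%N)
  (hmono : forall k l, (N0 < k)%N -> (k <= l)%N -> rho p k <= rho p l)
  (hlim : rho p @ \oo --> (1 : R)) :
  ((Dseries p < +oo)%E ->
     forall (a : nat) (A B : set nat), (1 <= a)%N ->
       A `<=` [set m | (a <= m)%N] -> B `<=` [set m | (1 <= m <= a)%N] ->
       {ae P, forall w, finite_set (Cset (X w) A [set a])} /\
       {ae P, forall w, finite_set (Cset (X w) [set a] B)} /\
       {ae P, forall w, finite_set (Cw (X w))})
  /\
  ((exists (n0 : nat) (delta : R), (0 < n0)%N /\ 0 < delta /\
      forall n, (n0 <= n)%N -> (Dinf p n <= (delta * n%:R * ln n%:R)%:E)%E) ->
   Dseries p = +oo%E ->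
     forall (a : nat) (A B : set nat), (1 <= a)%N ->
       A `<=` [set m | (a <= m)%N] -> A !=set0 ->
       B `<=` [set m | (1 <= m <= a)%N] -> B !=set0 ->
       {ae P, forall w, infinite_set (Cset (X w) A [set a])} /\
       {ae P, forall w, infinite_set (Cset (X w) [set a] B)} /\
       {ae P, forall w, infinite_set (Cw (X w))}).
Proof.
have p_gt0 x : 0 < p x by case: x => [|x]; [rewrite hp0|case: (hp x.+1)].
have p_le1 x : p x <= 1.
  by case: x => [|x]; [rewrite hp0|case: (hp x.+1) => // _; rewrite subr_gt0 => /ltW].
have rho_le1 x : (N0 < x)%N -> rho p x <= 1.
  move=> xN; apply: (cvgr_to_ge hlim); near=> l; apply: hmono => //.
  by near: l; exact: nbhs_infty_ge.
have p_half x : (N0.+1 <= x)%N -> 1 / 2 <= p x.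
  by move=> /rho_le1; rewrite /rho ler_pdivrMr // mul1r; lra.
have good_w : {ae P, forall w, good X w} := good_ae hp0 p_gt0 p_le1 hX.
split=> [Dfin a A B a1 hA hB|[n0 [delta [n0_gt0 [delta0 hD]]]] Doo a A B a1 hA A0 hB B0].
  have half01 : 0 <= (1 / 2 : R) <= 1 by apply/andP; split; lra.
  (* Sites of [C(A, a)] and of [C(a, B)] have at most [a] upcrossings, so one type serves both. *)
  have fin_ups := finitely_many_typ hp0 p_gt0 p_le1 hX rho_le1
    (exprn_gt0 a (divr_gt0 ltr01 (ltr0Sn R 1)))
    (typ_ups_le p_gt0 p_le1 a half01 p_half) Dfin.
  have fin_du := finitely_many_typ hp0 p_gt0 p_le1 hX rho_le1
    (divr_gt0 ltr01 (ltr0Sn R 1)) (typ_down_up p_gt0 p_le1 p_half) Dfin.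
  have sub_ups w x b : good X w -> (b <= a)%N -> upcross_eq (X w) x b ->
      typ_sites X (fun u => ups u <= a)%N w x.
    move=> gw ba [N' h]; exists N' => N NN'; have [T hT] := good_hit N gw.
    exists T => //; rewrite ups_word h //.
    exact: leq_trans NN' (first_hit_ge (proj1 gw) hT).
  split; [|split].
  - apply: filterS2 good_w fin_ups => w gw; apply: sub_finite_set => x [_ [b -> hx]].
    exact: sub_ups hx.
  - apply: filterS2 good_w fin_ups => w gw; apply: sub_finite_set => x [_ [b /hB/andP[_ ba] hx]].
    exact: sub_ups hx.
  - apply: filterS2 good_w fin_du => w gw; apply: sub_finite_set => x Cx.
    exists 0%N => N _; have [T hT] := good_hit N gw; exists T => //.
    exact: Cw_down_up (proj1 gw) Cx.
(* As the ratios tend to 1, [1 - p x >= p x / 2 >= 1 / 4] far out, so each prescribed word keeps a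
   weight bounded away from zero. *)
have [N2 hN2] : exists N2, forall x, (N2 <= x)%N -> 1 / 2 <= rho p x.
  have : \forall x \near \oo, 1 / 2 <= rho p x by apply: (cvgr_ge _ hlim); lra.
  by move=> [N2 _ h]; exists N2 => x xN; exact: h.
pose a' := maxn (maxn N0.+1 N2) (maxn n0 2).
have a'N0 : (N0.+1 <= a')%N by rewrite /a' !leq_max leqnn.
have a'N2 : (N2 <= a')%N by rewrite /a' !leq_max leqnn orbT.
have a'n0 : (n0 <= a')%N by rewrite /a' !leq_max leqnn !orbT.
have a'2 : (2 <= a')%N by rewrite /a' !leq_max leqnn !orbT.
have p_quarter x : (a' <= x)%N -> 1 / 4 <= p x.
  by move=> xa; have := p_half x (leq_trans a'N0 xa); lra.
have q_quarter x : (a' <= x)%N -> 1 / 4 <= 1 - p x.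
  move=> xa; have := hN2 x (leq_trans a'N2 xa).
  rewrite /rho ler_pdivlMr //; have := p_half x (leq_trans a'N0 xa); lra.
pose B' i : R := ln (1 + delta) + 4 * ln i%:R.
have lnd : 0 <= ln (1 + delta) by rewrite ln_ge0 // lerDl ltW.
have ln2 : 0 < ln (2 : R) by rewrite ln_gt0 // ltr1n.
(* The 48 is [12 * 4] from the term [4 * ln i] of [B']; the remaining part decreases in [i] and is
   taken at 2. *)
pose C := (ln (2 : R))^-1 * (6 + 12 * ln (1 + delta)) + 48.
have C0 : 0 <= C by rewrite addr_ge0 // mulr_ge0 ?invr_ge0 ?(ltW ln2) //; lra.
have lnB i k : (a' <= i)%N -> (i.+2 < k)%N -> ln (Dmn p i.+2 k) <= B' i.
  move=> ai ik; apply: ln_Dmn_le => //; first exact: leq_trans ai.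
  by apply: hD; lia.
have BC i : (a' <= i)%N -> (ln (i%:R : R))^-1 * (6 + 12 * B' i) <= C.
  move=> ai; have i2 : (2 <= i)%N by exact: leq_trans ai.
  have lni : ln (2 : R) <= ln (i%:R : R) by rewrite ler_ln ?posrE ?ltr0n ?ler_nat //; lia.
  have lni0 : 0 < ln (i%:R : R) by apply: lt_le_trans lni.
  have -> : (ln (i%:R : R))^-1 * (6 + 12 * B' i) =
      (ln i%:R)^-1 * (6 + 12 * ln (1 + delta)) + 48.
    by rewrite /B'; field; rewrite lt0r_neq0.
  by rewrite lerD2r ler_wpM2r ?lef_pV2 ?posrE //; lra.
have inf m n : {ae P, forall w, good X w /\ infinite_set (pat_sites X m n w)}.
  pose c0 : R := (1 / 4) ^+ size (pat2 n) *
    ((1 / 4) ^+ size (pat1 m n) * (1 / 4) ^+ size (pat0 m)).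
  have quarter0 : 0 < 1 / 4 :> R by lra.
  have c00 : 0 < c0 by rewrite !mulr_gt0 // exprn_gt0.
  have c0_le j : (a' <= j)%N -> c0 <= pat_weight p m n j.
    move=> aj; have h x u : (a' <= x)%N -> (1 / 4) ^+ size u <= wt p x u.
      by move=> ax; apply: wt_ge_pow; [exact: ltW|exact: p_quarter|exact: q_quarter].
    have e0 k : 0 <= (1 / 4 : R) ^+ k by rewrite exprn_ge0 // ltW.
    rewrite /c0 /pat_weight; apply: ler_pM; rewrite ?mulr_ge0 ?h //; first lia.
    by apply: ler_pM; rewrite ?h //; lia.
  exact: (infinitely_many_pattern hp0 p_gt0 p_le1 hX rho_le1 (ltnW a'N0) a'2 lnB BC C0 c00 c0_le Doo).
split; [|split].
- have [k Ak] := A0; have ak : (a <= k)%N := hA _ Ak.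
  (* The word at [j + 1] has [k - a] down and [a] up letters: [k] visits, [a] of them followed by a
     step up. *)
  apply: filterS (inf (k - a)%N a.-1) => w [gw]; move=> /infinite_succ_image; apply => j.
  move=> /(pat_sites_Cset gw); rewrite prednK // subnK //.
  by apply: Cset_sub => // _ ->.
- have [k Bk] := B0; have /andP[k1 ka] : (1 <= k <= a)%N := hB _ Bk.
  apply: filterS (inf (a - k)%N k.-1) => w [gw]; move=> /infinite_succ_image; apply => j.
  move=> /(pat_sites_Cset gw); rewrite prednK // subnK //.
  by apply: Cset_sub => // _ ->.
(* With [m = n = 0] the word at [j + 1] remains a single up letter, so the walk never steps down
   from [j + 1]. *)
- apply: filterS (inf 0%N 0%N) => w [gw]; move=> /infinite_succ_image; apply => j.
  move=> /(pat_sites_word gw)[T0 h]; apply: upcross_Cw (proj1 gw) (proj2 gw) _ => t.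
  have [s] := word_prefix (X w) j.+1 (leq_maxr T0 t).
  rewrite h ?leq_maxl // => /(congr1 (count negb)); rewrite count_cat /=; lia.
Unshelve. all: by end_near. Qed.
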